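(* For any $N_H,N_x\in\mathbb{N}$, consider the approximate solution $(f_{N_H,N_x},E_{N_H,N_x})$ given by $$f_{N_H,N_x}(t,x,v)=\sum_{n=0}^{N_H-1}\sum_{j=-N_x}^{N_x}c_n^j(t)\,e_j(x)\,\Psi_n(t,v),\qquad E_{N_H,N_x}(t,x)=\sum_{j=-N_x}^{N_x}E^j(t)\,e_j(x),$$ whose coefficients $(c_n^j,E^j)_j$ solve the Fourier-Hermite discretization of the Vlasov-Poisson system given in the context. Then: (1) Mass, momentum and total energy are conserved, that is, $$\frac{d}{dt}\left[\frac{c_k^0}{\alpha^k}\right](t)=0,\qquad k=0,1,$$ and, for the total energy, $$\mathcal{E}_{N_H,N_x}(t):=\frac12\,\frac{1}{\alpha^2(t)}\left(\sqrt2\,c_2^0(t)+c_0^0(t)\right)+\frac12\sum_{j=-N_x}^{N_x}|E^j(t)|^2=\mathcal{E}_{N_H,N_x}(0).$$ (2) Furthermore, assuming that $\|f_{N_H,N_x}(0)\|_{\omega(0)}<+\infty$, the approximate distribution function satisfies the stability estimate $$\|f_{N_H,N_x}(t)\|_{\omega(t)}\le\|f_{N_H,N_x}(0)\|_{\omega(0)}\,e^{t/(4\gamma)}\qquad\text{for all }t\ge0.$$ (3) Finally, for $T>0$, there exists a constant $C_T>0$ such that $\|E_{N_H,N_x}(t)\|_\infty\le C_T$ for all $t\in[0,T]$.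
   Context: Let $L>0$, $\alpha_0>0$, $\gamma>0$. Let $e_j(x)=\frac1{\sqrt L}e^{2\mathrm{i}\pi jx/L}$ and $V_{N_x}=\mathrm{span}\{e_j:\ j=-N_x,\dots,N_x\}$ on $(0,L)$. Hermite polynomials: $H_{-1}=0$, $H_0=1$, $\sqrt n\,H_n(\xi)=\xi H_{n-1}(\xi)-\sqrt{n-1}\,H_{n-2}(\xi)$ for $n\ge1$. Basis functions: $\Psi_n(t,v)=\alpha(t)\,H_n(\alpha(t)v)\,\frac{e^{-(\alpha(t)v)^2/2}}{\sqrt{2\pi}}$, where $$\alpha(t)=\alpha_0\left(1+\gamma\int_0^t\|E_{N_H,N_x}(s)\|_\infty^2\,ds\right)^{-1/2},$$ and $\|\cdot\|_\infty$ is the sup norm in $x$; $\alpha'$ denotes the time derivative of $\alpha$. Weight and norm: $\omega(t,v)=\sqrt{2\pi}\,e^{(\alpha(t)v)^2/2}$ and $\|u\|_{\omega(t)}^2=\int_0^L\int_{\mathbb{R}}|u(x,v)|^2\,\omega(t,v)\,dv\,dx$. Fourier-Hermite discretization: set $C_n(t,x)=\sum_{j=-N_x}^{N_x}c_n^j(t)e_j(x)$ for $0\le n\le N_H-1$, with the convention $C_n=0$ (and $c_n^j=0$) for $n<0$ and for $n\ge N_H$, and write $E=E_{N_H,N_x}$. The functions $C_n(t,\cdot)$, $\partial_tC_n(t,\cdot)$, $E(t,\cdot)$, $\partial_tE(t,\cdot)$ and a potential $\Phi(t,\cdot)$ belong to $V_{N_x}$ and are real-valued, and for all $\varphi_n\in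 V_{N_x}$, $0\le n\le N_H-1$, $$\frac{d}{dt}\int_0^LC_n\varphi_n\,dx-\frac{\alpha'}{\alpha}\int_0^L\left(nC_n+\sqrt{(n-1)n}\,C_{n-2}\right)\varphi_n\,dx-\frac1\alpha\int_0^L\left(\sqrt n\,C_{n-1}+\sqrt{n+1}\,C_{n+1}\right)\varphi_n'\,dx-\alpha\sqrt n\int_0^LE\,C_{n-1}\varphi_n\,dx=0,$$ and for all $\eta,\zeta\in V_{N_x}$, $$\int_0^L\Phi\,\eta'\,dx=\int_0^LE\,\eta\,dx,\qquad-\int_0^LE\,\zeta'\,dx=\int_0^L(C_0-\rho_0)\,\zeta\,dx,$$ where $\rho_0$ is the constant with $\int_0^L(C_0-\rho_0)\,dx=0$.
   Formalization: The kinetic term of the energy carries a factor √L (the printed sum is not conserved for L≠1); energy conservation excludes N_H=1,2, where it fails; the stability rate is e^{α_0² t/(4γ)} instead of e^{t/(4γ)}, which is false for large α_0. *)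

(* Defs.v *)
From HB Require Import structures.
From mathcomp Require Import all_boot all_order all_algebra.
From mathcomp Require Import all_classical all_reals all_analysis.
From mathcomp Require Export complex.
Import Order.TTheory GRing.Theory Num.Theory.
Import numFieldNormedType.Exports.

Set Implicit Arguments.
Unset Strict Implicit.
Unset Printing Implicit Defensive.

Local Open Scope classical_set_scope.
Local Open Scope ring_scope.
Local Open Scope complex_scope.

Section Calculus.
Context {R : realType}.
Local Notation mu := (@lebesgue_measure R).

(* Time derivatives are taken within [0, +oo[: two-sided for t > 0 and
   one-sided at t = 0. Complex-valued functions of a real variable are
   differentiated and integrated componentwise. *)
Definition has_dt (f : R -> R) (t l : R) : Prop :=
  (f s - f t) / (s - t) @[s --> within `[0, +oo[ (t^')] --> l.

Definition dt (f : R -> R) (t : R) : R :=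
  lim ((f s - f t) / (s - t) @[s --> within `[0, +oo[ (t^')]).

Definition has_cdt (f : R -> R[i]) (t : R) (l : R[i]) : Prop :=
  has_dt (fun s => complex.Re (f s)) t (complex.Re l) /\
  has_dt (fun s => complex.Im (f s)) t (complex.Im l).

Definition cdt (f : R -> R[i]) (t : R) : R[i] :=
  dt (fun s => complex.Re (f s)) t +i* dt (fun s => complex.Im (f s)) t.

Definition cdx (f : R -> R[i]) (x : R) : R[i] :=
  derive1 (fun y => complex.Re (f y)) x
  +i* derive1 (fun y => complex.Im (f y)) x.

Definition cint (L : R) (f : R -> R[i]) : R[i] :=
  (\int[mu]_(x in `]0, L[) complex.Re (f x))
  +i* (\int[mu]_(x in `]0, L[) complex.Im (f x)).

End Calculus.

Section FourierHermite.
Context {R : realType}.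
Local Notation mu := (@lebesgue_measure R).
Variable L : R.

Definition fourier (j : int) (x : R) : R[i] :=
  ((Num.sqrt L)^-1)%:C *
  (cos (2 * pi * j%:~R * x / L) +i* sin (2 * pi * j%:~R * x / L)).

(* frequency Nx i runs through -Nx, ..., Nx as i runs through 0, ..., 2 Nx *)
Definition frequency (Nx : nat) (i : 'I_(Nx.*2.+1)) : int :=
  (i : nat)%:Z - Nx%:Z.

Definition fourier_sum (Nx : nat) (a : int -> R[i]) (x : R) : R[i] :=
  \sum_(i < Nx.*2.+1) a (frequency i) * fourier (frequency i) x.

Definition VNx (Nx : nat) : set (R -> R[i]) :=
  [set phi | exists a : int -> R[i], phi = fourier_sum Nx a].

Definition real_valued (u : R -> R[i]) : Prop :=
  forall x, complex.Im (u x) = 0.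

(* The inner match is H_{n-2}, with H_{-1} = 0. *)
Fixpoint hermite (n : nat) (xi : R) : R :=
  if n is m.+1 then
    (xi * hermite m xi
     - Num.sqrt m%:R * (if m is k.+1 then hermite k xi else 0))
    / Num.sqrt (m.+1)%:R
  else 1.

Definition sup_norm (u : R -> R[i]) : R :=
  sup [set Normc.normc (u x) | x in `]0, L[].

Section Scaling.
Variables (alpha0 gamma : R) (Nx : nat) (Ec : int -> R -> R[i]).

(* Ec j t is the coefficient E^j(t). *)
Definition electric_field (t x : R) : R[i] := fourier_sum Nx (Ec ^~ t) x.

Definition alpha (t : R) : R :=
  alpha0 / Num.sqrt (1 + gamma *
    \int[mu]_(s in `[0, t]) (sup_norm (electric_field s)) ^+ 2).

Definition Psi (n : nat) (t v : R) : R :=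
  alpha t * hermite n (alpha t * v)
  * (expR (- (alpha t * v) ^+ 2 / 2) / Num.sqrt (2 * pi)).

Definition weight (t v : R) : R :=
  Num.sqrt (2 * pi) * expR ((alpha t * v) ^+ 2 / 2).

Definition weighted_norm (t : R) (u : R -> R -> R[i]) : \bar R :=
  sqrte (\int[mu]_(x in `]0%R, L[)
    \int[mu]_v ((Normc.normc (u x v)) ^+ 2 * weight t v)%:E)%E.

(* c n j t is the coefficient c_n^j(t); n is an integer so that the indices
   n - 1 and n - 2 occurring in the scheme are genuine. *)
Variables (NH : nat) (c : int -> int -> R -> R[i]).

Definition hermite_coef (n : int) (t x : R) : R[i] :=
  fourier_sum Nx (fun j => c n j t) x.

Definition FH_distribution (t x v : R) : R[i] :=
  \sum_(n < NH) \sum_(i < Nx.*2.+1)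
    c (n : nat)%:Z (frequency i) t * fourier (frequency i) x
    * (Psi n t v)%:C.

Local Notation C := hermite_coef.
Local Notation a := alpha.
Local Notation E := electric_field.

(* Differentiability of the coefficients says that the time derivatives of
   C n t and E t exist and belong to VNx; they are then real-valued as well.
   rho0 t is constant in x; its independence of t is not assumed, since it
   amounts to the conservation of mass. *)
Record FourierHermite_solution (Phi : R -> R -> R[i]) (rho0 : R -> R) : Prop :=
  { fh_convention : forall n j t, n < 0 \/ NH%:Z <= n -> c n j t = 0 ;
    fh_coef_derivable : forall n j t, `|j| <= Nx%:Z -> 0 <= t ->
      exists l, has_cdt (c n j) t l ;
    fh_field_derivable : forall j t, `|j| <= Nx%:Z -> 0 <= t ->
      exists l, has_cdt (Ec j) t l ;
    fh_coef_real : forall n t, 0 <= t -> real_valued (C n t) ;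
    fh_field_real : forall t, 0 <= t -> real_valued (E t) ;
    fh_potential : forall t, 0 <= t -> VNx Nx (Phi t) ;
    fh_potential_real : forall t, 0 <= t -> real_valued (Phi t) ;
    fh_vlasov : forall (n : nat) t phi, (n < NH)%N -> 0 <= t -> VNx Nx phi ->
      cdt (fun s => cint L (fun x => C n s x * phi x)) t
      - (dt a t / a t)%:C
        * cint L (fun x => (n%:R * C n t x
            + (Num.sqrt ((n%:R - 1) * n%:R))%:C * C (n%:Z - 2) t x) * phi x)
      - ((a t)^-1)%:C
        * cint L (fun x => ((Num.sqrt n%:R)%:C * C (n%:Z - 1) t x
            + (Num.sqrt (n.+1)%:R)%:C * C (n%:Z + 1) t x) * cdx phi x)
      - (a t * Num.sqrt n%:R)%:C
        * cint L (fun x => E t x * C (n%:Z - 1) t x * phi x) = 0 ;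
    fh_poisson_potential : forall t eta, 0 <= t -> VNx Nx eta ->
      cint L (fun x => Phi t x * cdx eta x) =
      cint L (fun x => E t x * eta x) ;
    fh_poisson_field : forall t zeta, 0 <= t -> VNx Nx zeta ->
      - cint L (fun x => E t x * cdx zeta x) =
      cint L (fun x => (C 0 t x - (rho0 t)%:C) * zeta x) ;
    fh_neutrality : forall t, 0 <= t ->
      cint L (fun x => C 0 t x - (rho0 t)%:C) = 0 }.

(* The factor sqrt L comes from e_0 = 1 / sqrt L: the integral of C_n over
   (0, L) is sqrt L * c_n^0, so that the first term is the kinetic energy,
   i.e. half the integral of v^2 f. Without this factor (and for L <> 1) the
   sum of the two terms is not conserved. *)
Definition total_energy (t : R) : R[i] :=
  (Num.sqrt L / (2 * (a t) ^+ 2))%:C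
    * ((Num.sqrt 2)%:C * c 2 0 t + c 0 0 t)
  + (2^-1 * \sum_(i < Nx.*2.+1)
      (Normc.normc (Ec (frequency i) t)) ^+ 2)%:C.

End Scaling.
End FourierHermite.

(* Main.v *)
Require Import Defs.
From mathcomp Require Import all_boot all_order all_algebra.
From mathcomp Require Import all_classical all_reals all_analysis.
From mathcomp Require Import measurable_realfun.
From mathcomp Require Import ring lra zify.
Import Order.TTheory GRing.Theory Num.Theory.
Import numFieldNormedType.Exports.

Local Open Scope classical_set_scope.
Local Open Scope ring_scope.
Local Open Scope complex_scope.

Set Implicit Arguments.
Unset Strict Implicit.
Unset Printing Implicit Defensive.

(** Testing the scheme with the modes [e_(-k)] turns it into a system for the
Fourier coefficients, in which [int_0^L u w dx] becomes the bilinear pairing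
[sum_j u_j w_(-j)] and [d/dx] multiplication by the antisymmetric symbol
[kap j = 2 i pi j / L]. The Poisson equations then read [kap k E_k = c_0^k] for
[k <> 0] and [E_0 = 0]. Hence [int E C_0 = 0], which gives the conservation of
momentum, and [E_k' = - c_1^k / alpha], which balances the kinetic energy.

For the stability estimate, orthonormality of the Hermite polynomials for the
Gaussian weight gives [|f(t)|^2 = alpha sum_n |C_n|^2]. In the time derivative of
this quantity the transport terms telescope, and the terms in [alpha'] form the
negative square [alpha' sum_n |sqrt (n+1) C_(n+1) + sqrt n C_(n-1)|^2]. As
[alpha'/alpha = - gamma (alpha/alpha0)^2 |E|_oo^2 / 2], Young's inequality absorbs
the field term into that square and Gronwall's lemma concludes.

The bound on [E] is continuity of [t |-> |E(t)|_oo] on [[0, T]]. *)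

(** * Time derivatives on the half-line *)

(** The choice of [alpha] decides the estimate: [- alpha' / alpha] is proportional to
    [(alpha * |E|_oo)^2], the square of a bound for the coefficient of the field term. The quotient
    produced by Young's inequality is therefore bounded by the constant [alpha0^2 / (2 gamma)],
    whatever the solution; passing from the squared norm to the norm halves it.

    The technical obstacle is that everything lives on [t >= 0] with a one-sided derivative at 0,
    whereas the theorems of calculus are two-sided. Monotonicity arguments need derivatives only
    inside the open interval, together with continuity up to 0. The primitive inside [alpha] is
    handled by freezing its integrand at the value in 0 for negative times. Differentiating that
    primitive requires [|E|_oo] to be continuous in time, which holds because the sup norm is
    Lipschitz in the finitely many Fourier coefficients. *)

Section OneSidedDerivative.
Context {R : realType}.
Implicit Types (f g : R -> R) (s t l m : R).

Local Notation nbhs0y t := (within `[0, +oo[ (nbhs t)).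
Local Notation dnbhs0y t := (within `[0, +oo[ (t^')).

(** For [t >= 0] every set of this filter is a right neighbourhood of [t]. Properness gives
    uniqueness of limits, hence the value of [dt], which is defined as a [lim]. *)
Lemma dnbhs0y_proper t : 0 <= t -> ProperFilter (dnbhs0y t).
Proof.
move=> t0; apply: Build_ProperFilter_ex => A tA.
have : t^'+ A.
  move: tA; rewrite /at_right /within /dnbhs /within /=.
  apply: (@filterS _ (nbhs t)) => s As ts; apply: As; first by rewrite gt_eqF.
  by rewrite in_itv /= (le_trans t0 (ltW ts)).
exact: filter_ex.
Qed.

Lemma dnbhs0y_sub t : dnbhs0y t `=>` nbhs0y t.
Proof. by move=> A; exact: nbhs_dnbhs. Qed.

Lemma near_dnbhs0y t : \forall s \near dnbhs0y t, s != t /\ 0 <= s.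
Proof.
rewrite near_withinE /dnbhs near_withinE.
by near=> s => st; rewrite /= in_itv /= andbT.
Unshelve. all: by end_near. Qed.

Lemma dtE f t l : 0 <= t -> has_dt f t l -> dt f t = l.
Proof.
by move=> t0 ftl; apply: cvg_lim => //; exact: dnbhs0y_proper.
Qed.

Lemma has_dt_continuous f t l : has_dt f t l -> f s @[s --> nbhs0y t] --> f t.
Proof.
move=> ftl.
have h : f s @[s --> dnbhs0y t] --> f t.
  have : (f s - f t) / (s - t) * (s - t) + f t @[s --> dnbhs0y t]
      --> l * (t - t) + f t.
    apply: cvgD; last exact: cvg_cst.
    apply: cvgM => //; apply: cvgB; last exact: cvg_cst.
    by apply: cvg_trans (@cvg_id _ (nbhs t)); apply: cvg_within_filter;
      exact: nbhs_dnbhs.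
  rewrite subrr mulr0 add0r; apply: cvg_trans; apply: near_eq_cvg.
  near=> s; rewrite /= divfK ?subrK// subr_eq0.
  by have [] := near (near_dnbhs0y t) s.
(* From the punctured filter to the full one: only the point [t] itself is added, and [f t] lies in
   each of its neighbourhoods. *)
move=> A fA; move: (h _ fA); rewrite /fmap/= /within/= /dnbhs /within/=.
apply: (@filterS _ (nbhs t)) => s /= + s0.
by have [->|st] := eqVneq s t => [_|/(_ isT s0)//]; exact: nbhs_singleton fA.
Unshelve. all: by end_near. Qed.

Lemma has_dt_cst (k t : R) : has_dt (fun=> k) t 0.
Proof.
rewrite /has_dt; apply: (@cvg_trans _ (cst (0 : R) @ dnbhs0y t)).
  by apply: near_eq_cvg; near=> s; rewrite /= subrr mul0r.
exact: cvg_cst.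
Unshelve. all: by end_near. Qed.

(** The scheme gives identities at nonnegative times only, so rewriting under a derivative may use
    no others. *)
Lemma has_dt_congr f g t l : 0 <= t -> (forall s, 0 <= s -> f s = g s) ->
  has_dt f t l -> has_dt g t l.
Proof.
move=> t0 fg; rewrite /has_dt; apply: cvg_trans; apply: near_eq_cvg.
near=> s; rewrite /= !fg//.
by have [] := near (near_dnbhs0y t) s.
Unshelve. all: by end_near. Qed.

Lemma has_dt_eq f g t l m : f =1 g -> l = m -> has_dt f t l -> has_dt g t m.
Proof. by move=> /funext -> ->. Qed.

Lemma has_dtD f g t l m : has_dt f t l -> has_dt g t m ->
  has_dt (fun s => f s + g s) t (l + m).
Proof.
move=> fl gm; rewrite /has_dt.
have h : (f s - f t) / (s - t) + (g s - g t) / (s - t) @[s --> dnbhs0y t]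
    --> l + m by exact: cvgD.
apply: cvg_trans h; apply: near_eq_cvg; near=> s.
by rewrite /=; ring.
Unshelve. all: by end_near. Qed.

Lemma has_dtM f g t l m : has_dt f t l -> has_dt g t m ->
  has_dt (fun s => f s * g s) t (l * g t + f t * m).
Proof.
move=> fl gm; rewrite /has_dt.
have gc : g s @[s --> dnbhs0y t] --> g t.
  by apply: cvg_trans (has_dt_continuous gm); apply: cvg_app; exact: dnbhs0y_sub.
have h : (f s - f t) / (s - t) * g s + f t * ((g s - g t) / (s - t))
    @[s --> dnbhs0y t] --> l * g t + f t * m.
  by apply: cvgD; apply: cvgM => //; exact: cvg_cst.
by apply: cvg_trans h; apply: near_eq_cvg; near=> s; rewrite /=; ring.
Unshelve. all: by end_near. Qed.

Lemma has_dtN f t l : has_dt f t l -> has_dt (fun s => - f s) t (- l).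
Proof.
move=> fl; have := has_dtM (has_dt_cst (-1) t) fl.
rewrite mul0r add0r mulN1r.
by congr has_dt; apply/funext => s; rewrite mulN1r.
Qed.

Lemma has_dtZ f t l k : has_dt f t l -> has_dt (fun s => k * f s) t (k * l).
Proof. by move=> fl; have := has_dtM (has_dt_cst k t) fl; rewrite mul0r add0r. Qed.

Lemma has_dtV f t l : f t != 0 -> has_dt f t l ->
  has_dt (fun s => (f s)^-1) t (- l / f t ^+ 2).
Proof.
move=> ft0 fl; rewrite /has_dt.
have fc : f s @[s --> dnbhs0y t] --> f t.
  by apply: cvg_trans (has_dt_continuous fl); apply: cvg_app; exact: dnbhs0y_sub.
have h : (- ((f s - f t) / (s - t))) * ((f s)^-1 * (f t)^-1)
    @[s --> dnbhs0y t] --> - l * ((f t)^-1 * (f t)^-1).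
  apply: cvgM; first exact: cvgN.
  by apply: cvgM; [exact: cvgV|exact: cvg_cst].
rewrite expr2 invfM; apply: cvg_trans h.
have fs0 : \forall s \near dnbhs0y t, f s != 0.
  exact: cvgr_neq0 fc ft0.
apply: near_eq_cvg; near=> s.
have fs : f s != 0 by near: s.
have st : s - t != 0.
  by rewrite subr_eq0; have [] := near (near_dnbhs0y t) s.
by rewrite /=; field; rewrite ft0 fs st.
Unshelve. all: by end_near. Qed.

Lemma has_dt_sqrt f t l : 0 <= t -> (forall s, 0 <= s -> 0 < f s) ->
  has_dt f t l ->
  has_dt (fun s => Num.sqrt (f s)) t (l / (2 * Num.sqrt (f t))).
Proof.
move=> t0 fpos fl; rewrite /has_dt.
have fc : Num.sqrt (f s) @[s --> dnbhs0y t] --> Num.sqrt (f t).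
  apply: continuous_cvg; first exact: sqrt_continuous.
  by apply: cvg_trans (has_dt_continuous fl); apply: cvg_app; exact: dnbhs0y_sub.
have ft0 : Num.sqrt (f t) != 0 by rewrite gt_eqF// sqrtr_gt0 fpos.
have h : ((f s - f t) / (s - t)) / (Num.sqrt (f s) + Num.sqrt (f t))
    @[s --> dnbhs0y t] --> l / (Num.sqrt (f t) + Num.sqrt (f t)).
  apply: cvgM => //; apply: cvgV; first by rewrite -mulr2n mulrn_eq0.
  by apply: cvgD => //; exact: cvg_cst.
rewrite mulr_natl mulr2n; apply: cvg_trans h.
apply: near_eq_cvg; near=> s.
have s0 : 0 <= s by have [] := near (near_dnbhs0y t) s.
have st' : s - t != 0.
  by rewrite subr_eq0; have [] := near (near_dnbhs0y t) s.
have q0 : Num.sqrt (f s) + Num.sqrt (f t) != 0.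
  by rewrite gt_eqF// addr_gt0// sqrtr_gt0 fpos.
have -> : f s - f t = (Num.sqrt (f s) - Num.sqrt (f t)) *
    (Num.sqrt (f s) + Num.sqrt (f t)).
  by rewrite -subr_sqr !sqr_sqrtr// ltW// fpos.
by rewrite /=; field; rewrite q0 st'.
Unshelve. all: by end_near. Qed.

Lemma has_dt_sum (I : Type) (r : seq I) (P : pred I) (F : I -> R -> R)
    (dF : I -> R) t : (forall i, P i -> has_dt (F i) t (dF i)) ->
  has_dt (fun s => \sum_(i <- r | P i) F i s) t (\sum_(i <- r | P i) dF i).
Proof.
move=> FdF; elim: r => [|i r ih].
  rewrite big_nil (_ : (fun _ => _) = fun=> 0); first exact: has_dt_cst.
  by apply/funext => s; rewrite big_nil.
rewrite big_cons (_ : (fun _ => _) = fun s => if P i then F i s +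
    \sum_(j <- r | P j) F j s else \sum_(j <- r | P j) F j s); last first.
  by apply/funext => s; rewrite big_cons.
by case: ifPn => // Pi; apply: has_dtD => //; exact: FdF.
Qed.

Lemma is_derive_has_dt f t l : is_derive t 1 f l -> has_dt f t l.
Proof.
move=> /is_derive1_caratheodory[g [fE gc <-]]; rewrite /has_dt.
have : g s @[s --> dnbhs0y t] --> g t.
  by apply: cvg_trans gc; apply: cvg_app; apply: cvg_trans (@nbhs_dnbhs _ t);
    exact: cvg_within.
apply: cvg_trans; apply: near_eq_cvg; near=> s.
rewrite /= fE mulfK// subr_eq0.
by have [] := near (near_dnbhs0y t) s.
Unshelve. all: by end_near. Qed.

(** For [t > 0] the half-line is a neighbourhood of [t], so the restriction is invisible; the slope
    completed by [l] at [t] is Caratheodory's function. *)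
Lemma has_dt_is_derive f t l : 0 < t -> has_dt f t l -> is_derive t 1 f l.
Proof.
move=> t0 fl; apply/is_derive1_caratheodory.
exists (fun s => if s == t then l else (f s - f t) / (s - t)); split.
- move=> z; case: (eqVneq z t) => [->|zt]; first by rewrite !subrr mulr0.
  by rewrite divfK// subr_eq0.
- rewrite /prop_for /continuous_at /= eqxx => A lA.
  have Al : A l by exact: nbhs_singleton lA.
  have h : \forall s \near t, s != t -> 0 <= s -> A ((f s - f t) / (s - t)).
    have := fl _ lA; rewrite /fmap/= /within/= /dnbhs /within/=.
    apply: (@filterS _ (nbhs t)) => s h st s0; apply: h => //.
    by rewrite in_itv/= s0.
  have s0 : \forall s \near t, 0 < s by exact: lt_nbhsr.
  suff : \forall s \near t, A (if s == t then l else (f s - f t) / (s - t)) by [].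
  near=> s; have [_//|st] := eqVneq s t.
  have s1 : 0 < s by near: s.
  by apply: (near h s) => //; exact: ltW.
- by rewrite eqxx.
Unshelve. all: by end_near. Qed.

Lemma has_dt_within_continuous f (df : R -> R) (b : R) :
  (forall t, 0 <= t -> has_dt f t (df t)) -> {within `[0, b], continuous f}.
Proof.
move=> fdf; apply/subspace_continuousP => x /=; rewrite in_itv/= => /andP[x0 _].
apply: cvg_trans (has_dt_continuous (fdf _ x0)); apply: cvg_app => A.
rewrite /within/=; apply: (@filterS _ (nbhs x)) => s As sb; apply: As.
by move: sb; rewrite !in_itv/= andbT => /andP[].
Qed.

(** The mean value theorem asks for derivatives inside []0, t[] and continuity on [[0, t]], so the
    one-sided derivative at 0 is enough. *)
Lemma has_dt_le0_nincr f (df : R -> R) t :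
  (forall s, 0 <= s -> has_dt f s (df s)) -> (forall s, 0 <= s -> df s <= 0) ->
  0 <= t -> f t <= f 0.
Proof.
move=> fdf df0; rewrite le_eqVlt => /predU1P[<-//|t0].
have fd x : x \in `]0, t[ -> is_derive x 1 f (df x).
  by rewrite in_itv/= => /andP[x0 _]; apply: has_dt_is_derive (fdf _ (ltW x0)).
apply: (@ler0_derive1_le_cc _ f 0 t).
- by move=> x /fd[].
- move=> x x0; rewrite derive1E; have [_ ->] := fd _ x0.
  by move: x0; rewrite in_itv/= => /andP[/ltW/df0].
- exact: has_dt_within_continuous fdf.
- by rewrite in_itv/= lexx ltW.
- by rewrite in_itv/= lexx ltW.
- exact: ltW.
Qed.

Lemma has_dt0_cst f t : (forall s, 0 <= s -> has_dt f s 0) -> 0 <= t ->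
  f t = f 0.
Proof.
move=> f0 t0; apply/eqP; rewrite eq_le; apply/andP; split.
  exact: (@has_dt_le0_nincr f (fun=> 0)).
rewrite -lerN2; apply: (@has_dt_le0_nincr (fun s => - f s) (fun=> - 0)) => [s s0|s _|//].
  exact/has_dtN/f0.
by rewrite oppr0.
Qed.

Lemma is_derive1_mull (k s : R) : is_derive s 1 (fun u => k * u) k.
Proof.
apply/is_derive1_caratheodory; exists (fun=> k); split => //.
  by move=> z; rewrite mulrBr.
exact: cvg_cst.
Qed.

(** With the integrating factor [expR (- K * s)] the product has a nonpositive derivative. *)
Lemma gronwall f (df : R -> R) (K t : R) :
  (forall s, 0 <= s -> has_dt f s (df s)) ->
  (forall s, 0 <= s -> df s <= K * f s) ->
  0 <= t -> f t <= f 0 * expR (K * t).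
Proof.
move=> fdf dfK t0.
have expd s : is_derive s 1 (fun u => expR (- K * u)) (- K * expR (- K * s)).
  rewrite mulrC; apply: (@is_derive1_comp _ expR (fun u => - K * u)).
  exact: is_derive1_mull.
have : f t * expR (- K * t) <= f 0 * expR (- K * 0).
  apply: (@has_dt_le0_nincr (fun s => f s * expR (- K * s))
    (fun s => df s * expR (- K * s) + f s * (- K * expR (- K * s)))) => // s s0.
    by apply: has_dtM; [exact: fdf|exact/is_derive_has_dt].
  rewrite mulrCA mulrA -mulrDl pmulr_lle0 ?expR_gt0//.
  by rewrite mulNr subr_le0 dfK.
by rewrite mulr0 expR0 mulr1 mulNr expRN ler_pdivrMr// expR_gt0.
Qed.

End OneSidedDerivative.

(** * Time derivatives of complex-valued functions *)

Section ComplexTimeDerivative.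
Context {R : realType}.
Implicit Types (f g : R -> R[i]) (s t : R) (l m : R[i]).

Lemma has_cdt_cst (k : R[i]) t : has_cdt (fun=> k) t 0.
Proof. by split; exact: has_dt_cst. Qed.

Lemma has_cdt_congr f g t l : 0 <= t -> (forall s, 0 <= s -> f s = g s) ->
  has_cdt f t l -> has_cdt g t l.
Proof.
by move=> t0 fg [fR fI]; split; [apply: has_dt_congr fR|apply: has_dt_congr fI];
  move=> // s s0; rewrite fg.
Qed.

Lemma has_cdtD f g t l m : has_cdt f t l -> has_cdt g t m ->
  has_cdt (fun s => f s + g s) t (l + m).
Proof.
move=> [fR fI] [gR gI]; split; rewrite raddfD /=.
  by apply: has_dt_eq (has_dtD fR gR) => // s; rewrite raddfD.
by apply: has_dt_eq (has_dtD fI gI) => // s; rewrite raddfD.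
Qed.

Lemma ReD (a b : R[i]) : complex.Re (a + b) = complex.Re a + complex.Re b.
Proof. by case: a b => [? ?] [? ?]. Qed.

Lemma ImD (a b : R[i]) : complex.Im (a + b) = complex.Im a + complex.Im b.
Proof. by case: a b => [? ?] [? ?]. Qed.

Lemma ReM (a b : R[i]) :
  complex.Re (a * b) = complex.Re a * complex.Re b - complex.Im a * complex.Im b.
Proof. by case: a b => [? ?] [? ?]. Qed.

Lemma ImM (a b : R[i]) :
  complex.Im (a * b) = complex.Re a * complex.Im b + complex.Im a * complex.Re b.
Proof. by case: a b => [? ?] [? ?]. Qed.

Lemma has_cdtM f g t l m : has_cdt f t l -> has_cdt g t m ->
  has_cdt (fun s => f s * g s) t (l * g t + f t * m).
Proof.
move=> [fR fI] [gR gI]; split.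
- apply: (has_dt_eq _ _ (has_dtD (has_dtM fR gR) (has_dtN (has_dtM fI gI)))).
    by move=> s; rewrite ReM.
  by rewrite ReD !ReM; ring.
- apply: (has_dt_eq _ _ (has_dtD (has_dtM fR gI) (has_dtM fI gR))).
    by move=> s; rewrite ImM.
  by rewrite ImD !ImM; ring.
Qed.

Lemma has_cdtZ (k : R[i]) f t l : has_cdt f t l ->
  has_cdt (fun s => k * f s) t (k * l).
Proof. by move=> /(has_cdtM (has_cdt_cst k t)); rewrite mul0r add0r. Qed.

Lemma has_cdt_sum (I : Type) (r : seq I) (F : I -> R -> R[i]) (dF : I -> R[i]) t :
  (forall i, has_cdt (F i) t (dF i)) ->
  has_cdt (fun s => \sum_(i <- r) F i s) t (\sum_(i <- r) dF i).
Proof.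
move=> FdF; elim: r => [|i r ih].
  rewrite big_nil (_ : (fun _ => _) = fun=> 0); first exact: has_cdt_cst.
  by apply/funext => s; rewrite big_nil.
rewrite big_cons (_ : (fun _ => _) = fun s => F i s + \sum_(j <- r) F j s).
  exact: has_cdtD.
by apply/funext => s; rewrite big_cons.
Qed.

Lemma has_cdt_real (f : R -> R) t (l : R) : has_dt f t l ->
  has_cdt (fun s => (f s)%:C) t l%:C.
Proof. by split => //=; exact: has_dt_cst. Qed.

Lemma cdtE f t l : 0 <= t -> has_cdt f t l -> cdt f t = l.
Proof. by move=> t0 [fR fI]; rewrite /cdt (dtE t0 fR) (dtE t0 fI); case: l {fR fI}. Qed.

Lemma has_cdt0_cst f t : (forall s, 0 <= s -> has_cdt f s 0) -> 0 <= t ->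
  f t = f 0.
Proof.
move=> f0 t0; apply/eqP; rewrite eq_complex; apply/andP; split; apply/eqP.
  by apply: (@has_dt0_cst _ (fun s => complex.Re (f s))) => // s /f0[].
by apply: (@has_dt0_cst _ (fun s => complex.Im (f s))) => // s /f0[].
Qed.

End ComplexTimeDerivative.

(** * Trigonometric polynomials *)

Section SpaceIntegral.
Context {R : realType}.
Local Notation mu := (@lebesgue_measure R).
Implicit Types (f g F : R -> R[i]).

Lemma continuous_integrable_oo (f : R -> R) (a b : R) : continuous f ->
  mu.-integrable `]a, b[ (EFin \o f).
Proof.
move=> cf; apply: (@integrableS _ _ _ mu `[a, b]) => //.
  exact: subset_itv_oo_cc.
apply: continuous_compact_integrable; first exact: segment_compact.
exact: continuous_subspaceT.
Qed.

Lemma continuous_bigsum (I : Type) (r : seq I) (f : I -> R -> R) :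
  (forall i, continuous (f i)) -> continuous (fun x => \sum_(i <- r) f i x).
Proof.
move=> cf x; apply: cvg_big => [|i _]; first exact: add_continuous.
exact: cf.
Qed.

Lemma Rintegral_bigsum (I : Type) (r : seq I) (f : I -> R -> R) (a b : R) :
  (forall i, continuous (f i)) ->
  \int[mu]_(x in `]a, b[) \sum_(i <- r) f i x =
  \sum_(i <- r) \int[mu]_(x in `]a, b[) f i x.
Proof.
move=> cf; elim: r => [|i r ih].
  by under eq_Rintegral do rewrite big_nil; rewrite Rintegral_cst// mul0r big_nil.
under eq_Rintegral do rewrite big_cons.
rewrite RintegralD ?ih ?big_cons//; apply: continuous_integrable_oo => //.
exact: continuous_bigsum.
Qed.

Lemma Rintegral_FTC2 (f F : R -> R) (a b : R) : a < b -> continuous f ->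
  (forall x : R, is_derive x 1 F (f x)) -> \int[mu]_(x in `]a, b[) f x = F b - F a.
Proof.
move=> ab cf dF.
have cF : continuous F.
  by move=> x; apply/differentiable_continuous/derivable1_diffP; case: (dF x).
rewrite Rintegral_itv_bndo_bndc; last first.
  apply: (@integrableS _ _ _ mu `[a, b]) => //; first exact: subset_itv_oo_cc.
  apply: continuous_compact_integrable; first exact: segment_compact.
  exact: continuous_subspaceT.
rewrite Rintegral_itv_obnd_cbnd; last first.
  apply: (@integrableS _ _ _ mu `[a, b]) => //; first exact: subset_itv_oc_cc.
  apply: continuous_compact_integrable; first exact: segment_compact.
  exact: continuous_subspaceT.
rewrite /Rintegral (@continuous_FTC2 _ f F)//.
- exact: continuous_subspaceT.
- split; first by move=> x _; case: (dF x).
    by apply: cvg_at_right_filter; exact: cF.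
  by apply: cvg_at_left_filter; exact: cF.
- by move=> x _; rewrite derive1E; case: (dF x).
Qed.

Definition ccontinuous f :=
  continuous (fun x => complex.Re (f x)) /\ continuous (fun x => complex.Im (f x)).

Lemma ccontinuous_cst (k : R[i]) : ccontinuous (fun=> k).
Proof. by split=> x; exact: cvg_cst. Qed.

Lemma ccontinuousD f g : ccontinuous f -> ccontinuous g ->
  ccontinuous (fun x => f x + g x).
Proof.
move=> [fR fI] [gR gI]; split.
  rewrite (_ : (fun _ => _) = fun x => complex.Re (f x) + complex.Re (g x)).
    by move=> x; apply: cvgD; [exact: fR|exact: gR].
  by apply/funext => x; rewrite ReD.
rewrite (_ : (fun _ => _) = fun x => complex.Im (f x) + complex.Im (g x)).
  by move=> x; apply: cvgD; [exact: fI|exact: gI].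
by apply/funext => x; rewrite ImD.
Qed.

Lemma ccontinuousM f g : ccontinuous f -> ccontinuous g ->
  ccontinuous (fun x => f x * g x).
Proof.
move=> [fR fI] [gR gI]; split.
  rewrite (_ : (fun _ => _) = fun x => complex.Re (f x) * complex.Re (g x)
      - complex.Im (f x) * complex.Im (g x)).
    by move=> x; apply: cvgB; apply: cvgM;
      [exact: fR|exact: gR|exact: fI|exact: gI].
  by apply/funext => x; rewrite ReM.
rewrite (_ : (fun _ => _) = fun x => complex.Re (f x) * complex.Im (g x)
    + complex.Im (f x) * complex.Re (g x)).
  by move=> x; apply: cvgD; apply: cvgM;
    [exact: fR|exact: gI|exact: fI|exact: gR].
by apply/funext => x; rewrite ImM.
Qed.

Lemma ccontinuousZ (k : R[i]) f : ccontinuous f -> ccontinuous (fun x => k * f x).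
Proof. by move=> cf; apply: ccontinuousM => //; exact: ccontinuous_cst. Qed.

Lemma ccontinuous_sum (I : Type) (r : seq I) (f : I -> R -> R[i]) :
  (forall i, ccontinuous (f i)) -> ccontinuous (fun x => \sum_(i <- r) f i x).
Proof.
move=> cf; elim: r => [|i r ih].
  rewrite (_ : (fun _ => _) = fun=> 0); first exact: ccontinuous_cst.
  by apply/funext => x; rewrite big_nil.
rewrite (_ : (fun _ => _) = fun x => f i x + \sum_(j <- r) f j x).
  exact: ccontinuousD.
by apply/funext => x; rewrite big_cons.
Qed.

Variable L : R.
Hypothesis L_gt0 : 0 < L.

Lemma cintD f g : ccontinuous f -> ccontinuous g ->
  cint L (fun x => f x + g x) = cint L f + cint L g.
Proof.
move=> [fR fI] [gR gI]; rewrite /cint.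
under eq_Rintegral do rewrite ReD.
rewrite RintegralD//; try exact: continuous_integrable_oo.
under [X in _ +i* X = _]eq_Rintegral do rewrite ImD.
by rewrite RintegralD//; exact: continuous_integrable_oo.
Qed.

Lemma cintZ (k : R[i]) f : ccontinuous f ->
  cint L (fun x => k * f x) = k * cint L f.
Proof.
move=> [fR fI].
have RZ (u : R) (h : R -> R) : continuous h ->
    \int[mu]_(x in `]0, L[) (u * h x) = u * \int[mu]_(x in `]0, L[) h x.
  by move=> ch; rewrite RintegralZl//; exact: continuous_integrable_oo.
have cZ (u : R) (h : R -> R) : continuous h -> continuous (fun x => u * h x).
  by move=> ch x; apply: cvgM; [exact: cvg_cst|exact: ch].
rewrite /cint; case: k => a b.
under eq_Rintegral do rewrite ReM /=.
rewrite RintegralB//; try by apply: continuous_integrable_oo; exact: cZ.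
under [X in _ +i* X]eq_Rintegral do rewrite ImM /=.
rewrite RintegralD//; try by apply: continuous_integrable_oo; exact: cZ.
by rewrite !RZ.
Qed.

Lemma cint_sum (I : Type) (r : seq I) (f : I -> R -> R[i]) :
  (forall i, ccontinuous (f i)) ->
  cint L (fun x => \sum_(i <- r) f i x) = \sum_(i <- r) cint L (f i).
Proof.
move=> cf; elim: r => [|i r ih].
  rewrite big_nil /cint.
  under eq_Rintegral do rewrite big_nil.
  under [X in _ +i* X]eq_Rintegral do rewrite big_nil.
  by rewrite /= !Rintegral_cst// !mul0r.
rewrite big_cons -ih -cintD//; last exact: ccontinuous_sum.
by congr cint; apply/funext => x; rewrite big_cons.
Qed.

Lemma cint_real f : real_valued f ->
  cint L f = (\int[mu]_(x in `]0, L[) complex.Re (f x))%:C.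
Proof.
move=> fr; rewrite /cint; congr (_ +i* _).
under eq_Rintegral do rewrite fr.
by rewrite Rintegral_cst// mul0r.
Qed.

Definition has_cdx f (x : R) (l : R[i]) :=
  is_derive x 1 (fun y => complex.Re (f y)) (complex.Re l) /\
  is_derive x 1 (fun y => complex.Im (f y)) (complex.Im l).

Lemma cdxE f x l : has_cdx f x l -> cdx f x = l.
Proof.
by move=> [[_ fR] [_ fI]]; rewrite /cdx !derive1E fR fI; case: l {fR fI}.
Qed.

Lemma has_cdxZ (k : R[i]) f x l : has_cdx f x l ->
  has_cdx (fun y => k * f y) x (k * l).
Proof.
case: k => a b [fR fI]; split.
  rewrite (_ : (fun _ => _) = (fun y => a * complex.Re (f y)) -
    (fun y => b * complex.Im (f y))); last by apply/funext => y; rewrite ReM.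
  by rewrite ReM; apply: is_deriveB; exact: is_deriveZ.
rewrite (_ : (fun _ => _) = (fun y => a * complex.Im (f y)) +
  (fun y => b * complex.Re (f y))); last by apply/funext => y; rewrite ImM.
by rewrite ImM; apply: is_deriveD; exact: is_deriveZ.
Qed.

Lemma has_cdx_sum n (F : 'I_n -> R -> R[i]) (dF : 'I_n -> R[i]) x :
  (forall i, has_cdx (F i) x (dF i)) ->
  has_cdx (fun y => \sum_(i < n) F i y) x (\sum_(i < n) dF i).
Proof.
have Re_sum (G : 'I_n -> R[i]) :
    complex.Re (\sum_(i < n) G i) = \sum_(i < n) complex.Re (G i).
  by rewrite (big_morph _ ReD (erefl _)).
have Im_sum (G : 'I_n -> R[i]) :
    complex.Im (\sum_(i < n) G i) = \sum_(i < n) complex.Im (G i).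
  by rewrite (big_morph _ ImD (erefl _)).
move=> FdF; split.
  rewrite (_ : (fun _ => _) = \sum_(i < n) (fun y => complex.Re (F i y))).
    by rewrite Re_sum; apply: is_derive_sum => i; case: (FdF i).
  by apply/funext => y; rewrite Re_sum fct_sumE.
rewrite (_ : (fun _ => _) = \sum_(i < n) (fun y => complex.Im (F i y))).
  by rewrite Im_sum; apply: is_derive_sum => i; case: (FdF i).
by apply/funext => y; rewrite Im_sum fct_sumE.
Qed.

Lemma cint_FTC2 f F : ccontinuous f -> (forall x, has_cdx F x (f x)) ->
  cint L f = F L - F 0.
Proof.
move=> [fR fI] FE; rewrite /cint.
have -> : \int[mu]_(x in `]0, L[) complex.Re (f x) =
    complex.Re (F L) - complex.Re (F 0).
  apply: (@Rintegral_FTC2 (fun x => complex.Re (f x))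
    (fun x => complex.Re (F x))) => // x.
  by case: (FE x).
have -> : \int[mu]_(x in `]0, L[) complex.Im (f x) =
    complex.Im (F L) - complex.Im (F 0).
  apply: (@Rintegral_FTC2 (fun x => complex.Im (f x))
    (fun x => complex.Im (F x))) => // x.
  by case: (FE x).
by case: (F L) (F 0) => [? ?] [? ?].
Qed.

End SpaceIntegral.

(** * The symmetric range of frequencies *)

Section Frequencies.
Variable Nx : nat.
Implicit Type k : int.
Local Notation freq := (@frequency Nx).

Lemma frequency_bound (i : 'I_(Nx.*2.+1)) : `|freq i| <= Nx%:Z.
Proof. by rewrite /frequency; have := ltn_ord i; lia. Qed.

Lemma frequency_rev (i : 'I_(Nx.*2.+1)) : freq (rev_ord i) = - freq i.
Proof. by rewrite /frequency /=; have := ltn_ord i; lia. Qed.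

Lemma frequency_inj : injective freq.
Proof. by move=> i k; rewrite /frequency => h; apply: val_inj => /=; lia. Qed.

Lemma frequency_surj k : `|k| <= Nx%:Z -> exists i, freq i = k.
Proof.
move=> kN; have h : (absz (k + Nx%:Z)%R < Nx.*2.+1)%N by lia.
by exists (Ordinal h); rewrite /frequency /=; lia.
Qed.

(** Reversing the ordinals negates the frequency. This symmetry of the range is behind the symmetry
    of the pairing, the antisymmetry of [d/dx] and the stability of [VNx] under conjugation. *)
Lemma sum_frequencyN (V : zmodType) (F : int -> V) :
  \sum_(i < Nx.*2.+1) F (- freq i) = \sum_(i < Nx.*2.+1) F (freq i).
Proof.
rewrite [RHS](reindex_inj rev_ord_inj) /=.
by apply: eq_bigr => i _; rewrite frequency_rev.
Qed.

Lemma sum_frequency_delta (A : pzRingType) (a : int -> A) k : `|k| <= Nx%:Z ->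
  \sum_(i < Nx.*2.+1) a (freq i) * (freq i == k)%:R = a k.
Proof.
move=> /frequency_surj[i0 <-]; rewrite (bigD1 i0)//= eqxx mulr1 big1 ?addr0//.
by move=> i ii0; rewrite (inj_eq frequency_inj) (negbTE ii0) mulr0.
Qed.

End Frequencies.

(** * Fourier modes: orthogonality, differentiation, conjugation *)

Section FourierSums.
Context {R : realType}.
Variables (L : R) (Nx : nat).
Hypothesis L_gt0 : 0 < L.
Implicit Types (a b : int -> R[i]) (j k : int).

Local Notation freq := (@frequency Nx).
Local Notation FS := (fourier_sum L Nx).

Definition wavenumber (j : int) : R[i] := 0 +i* (2 * pi * j%:~R / L).

Lemma wavenumber0 : wavenumber 0 = 0.
Proof. by rewrite /wavenumber mulr0 mul0r. Qed.

Lemma wavenumberN j : wavenumber (- j) = - wavenumber j.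
Proof.
by apply/eqP; rewrite eq_complex /= oppr0 eqxx /= rmorphN/= mulrN mulNr.
Qed.

Lemma wavenumber_eq0 j : (wavenumber j == 0) = (j == 0).
Proof.
rewrite eq_complex /= eqxx /= !mulf_eq0 invr_eq0 (gt_eqF L_gt0) orbF intr_eq0.
by rewrite (gt_eqF (pi_gt0 R)) pnatr_eq0.
Qed.

Lemma cos_2pi_int j : cos (2 * pi * j%:~R : R) = 1.
Proof.
have h n : cos (2 * pi * n%:R : R) = 1.
  have -> : 2 * pi * n%:R = 0 + pi *+ 2 *+ n :> R.
    by rewrite add0r -[_ *+ n]mulr_natr mulr2n; ring.
  by rewrite (periodicn (@cosD2pi R)) cos0.
case: j => n; first exact: h.
by rewrite NegzE mulrNz mulrN cosN; exact: h.
Qed.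

Lemma sin_2pi_int j : sin (2 * pi * j%:~R : R) = 0.
Proof.
have h n : sin (2 * pi * n%:R : R) = 0.
  have -> : 2 * pi * n%:R = 0 + pi *+ 2 *+ n :> R.
    by rewrite add0r -[_ *+ n]mulr_natr mulr2n; ring.
  by rewrite (periodicn (@sinD2pi R)) sin0.
case: j => n; first exact: h.
by rewrite NegzE mulrNz mulrN sinN; apply/eqP; rewrite oppr_eq0; apply/eqP/h.
Qed.

Lemma fourierL j : fourier L j L = fourier L j 0.
Proof.
by rewrite /fourier mulr0 mul0r cos0 sin0 mulfK ?gt_eqF// cos_2pi_int sin_2pi_int.
Qed.

Lemma fourier0 x : fourier L 0 x = ((Num.sqrt L)^-1)%:C.
Proof. by rewrite /fourier mulr0 !mul0r cos0 sin0 mulr1. Qed.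

Lemma fourierM j k x :
  fourier L j x * fourier L k x = ((Num.sqrt L)^-1)%:C * fourier L (j + k) x.
Proof.
rewrite /fourier mulrACA -mulrA; congr (_ * (_ * _)).
have -> : 2 * pi * (j + k)%:~R * x / L =
    2 * pi * j%:~R * x / L + 2 * pi * k%:~R * x / L by rewrite intrD; ring.
rewrite cosD sinD.
by apply/eqP; rewrite eq_complex /= eqxx /= addrC.
Qed.

Lemma fourier_conj j x : conjc (fourier L j x) = fourier L (- j) x.
Proof.
rewrite /fourier rmorphM /= oppr0 rmorphN/= mulrN !mulNr cosN sinN.
by [].
Qed.

Lemma has_cdx_fourier j x :
  has_cdx (fourier L j) x (wavenumber j * fourier L j x).
Proof.
pose w := 2 * pi * j%:~R / L.
rewrite /fourier mulrCA; apply: has_cdxZ.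
have d : is_derive x 1 (fun y => w * y) w by exact: is_derive1_mull.
have wE y : 2 * pi * j%:~R * y / L = w * y by rewrite /w mulrAC.
split => /=; under eq_fun do rewrite wE; rewrite wE -/w mul0r ?addr0 ?sub0r.
  by rewrite mulrC -mulNr; apply: (@is_derive1_comp _ (@cos R) (fun y => w * y)).
by rewrite add0r mulrC; apply: (@is_derive1_comp _ (@sin R) (fun y => w * y)).
Qed.

Lemma has_cdx_ccontinuous (f f' : R -> R[i]) :
  (forall x, has_cdx f x (f' x)) -> ccontinuous f.
Proof.
by move=> ff'; split => x; apply/differentiable_continuous/derivable1_diffP;
  case: (ff' x) => -[? _] [? _].
Qed.

Lemma ccontinuous_fourier j : ccontinuous (fourier L j).
Proof. exact: has_cdx_ccontinuous (has_cdx_fourier j). Qed.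

Lemma ccontinuous_fourier_sum a : ccontinuous (FS a).
Proof.
by apply: ccontinuous_sum => i; apply: ccontinuousZ; exact: ccontinuous_fourier.
Qed.

Lemma cint_fourier j : cint L (fourier L j) = (Num.sqrt L)%:C *+ (j == 0).
Proof.
have [->|j0] := eqVneq j 0.
  rewrite (_ : fourier L 0 = fun=> ((Num.sqrt L)^-1)%:C); last first.
    by apply/funext => x; rewrite fourier0.
  rewrite cint_real//= Rintegral_cst//= lebesgue_measure_itv/= lte_fin L_gt0/=.
  rewrite subr0 -{2}(sqr_sqrtr (ltW L_gt0)) expr2 mulKf//.
  by rewrite gt_eqF// sqrtr_gt0.
have k0 : wavenumber j != 0 by rewrite wavenumber_eq0.
(* Multiplied by its nonzero wavenumber, the mode is the derivative of a periodic function, so its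
   integral is a difference of equal end values. *)
apply: (mulfI k0); rewrite mulr0 -cintZ; last exact: ccontinuous_fourier.
rewrite (cint_FTC2 L_gt0 _ (has_cdx_fourier j)); first by rewrite fourierL subrr.
by apply: ccontinuousZ; exact: ccontinuous_fourier.
Qed.

(** No conjugate is taken, so [e_j] is dual to [e_(-j)]: this is the origin of the reflected index
    in all later sums. *)
Lemma cint_fourierM j k :
  cint L (fun x => fourier L j x * fourier L k x) = (j + k == 0)%:R.
Proof.
rewrite (_ : (fun _ => _) = fun x => ((Num.sqrt L)^-1)%:C * fourier L (j + k) x).
  rewrite cintZ; last exact: ccontinuous_fourier.
  rewrite cint_fourier mulrnAr -rmorphM /= mulVf//.
  by rewrite gt_eqF// sqrtr_gt0.
by apply/funext => x; rewrite fourierM.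
Qed.

Lemma cint_fourier_sumM a b :
  cint L (fun x => FS a x * FS b x) =
  \sum_(i < Nx.*2.+1) a (freq i) * b (- freq i).
Proof.
rewrite (_ : (fun _ => _) = fun x => \sum_(i < Nx.*2.+1) \sum_(k < Nx.*2.+1)
    a (freq i) * b (freq k) * (fourier L (freq i) x * fourier L (freq k) x)).
  have cc (i k : 'I_(Nx.*2.+1)) : ccontinuous (fun x => a (freq i) * b (freq k) *
      (fourier L (freq i) x * fourier L (freq k) x)).
    by apply: ccontinuousZ; apply: ccontinuousM; exact: ccontinuous_fourier.
  rewrite cint_sum; last by move=> i; exact: ccontinuous_sum.
  apply: eq_bigr => i _; rewrite cint_sum//.
  have Ni : `|- freq i| <= Nx%:Z by rewrite normrN frequency_bound.
  rewrite -(sum_frequency_delta b Ni) mulr_sumr; apply: eq_bigr => k _.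
  rewrite cintZ; last by apply: ccontinuousM; exact: ccontinuous_fourier.
  by rewrite cint_fourierM addrC addr_eq0 mulrA.
apply/funext => x; rewrite /fourier_sum mulr_suml; apply: eq_bigr => i _.
by rewrite mulr_sumr; apply: eq_bigr => k _; rewrite mulrACA.
Qed.

Lemma cdx_fourier_sum a : cdx (FS a) = FS (fun j => wavenumber j * a j).
Proof.
apply/funext => x; apply: cdxE; rewrite /fourier_sum.
apply: has_cdx_sum => i; rewrite mulrAC -mulrA mulrC -mulrA.
rewrite [X in has_cdx _ _ X]mulrCA.
by apply: has_cdxZ; rewrite mulrC; exact: has_cdx_fourier.
Qed.

Lemma fourier_sum_delta k x : `|k| <= Nx%:Z ->
  FS (fun j => (j == k)%:R) x = fourier L k x.
Proof.
move=> kN; rewrite -(sum_frequency_delta (fun j => fourier L j x) kN).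
by apply: eq_bigr => i _; rewrite mulrC.
Qed.

Lemma conjcM (x y : R[i]) : conjc (x * y) = conjc x * conjc y.
Proof. exact: rmorphM. Qed.

Lemma fourier_sum_conj a x : conjc (FS a x) = FS (fun j => conjc (a (- j))) x.
Proof.
rewrite /fourier_sum rmorph_sum /=.
rewrite -(@sum_frequencyN Nx _ (fun j => conjc (a (- j)) * fourier L j x)).
by apply: eq_bigr => i _; rewrite opprK conjcM fourier_conj.
Qed.

Lemma cint_delta_fourier_sum a k : `|k| <= Nx%:Z ->
  cint L (fun x => FS a x * FS (fun j => (j == - k)%:R) x) = a k.
Proof.
move=> kN; rewrite cint_fourier_sumM -[RHS](sum_frequency_delta a kN).
by apply: eq_bigr => i _; rewrite eqr_opp.
Qed.

(** A real sum equals its conjugate, which has the coefficients [conjc (a (- j))]; testing both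
    expressions with the same mode compares coefficients. *)
Lemma real_fourier_sum_coef a k : real_valued (FS a) -> `|k| <= Nx%:Z ->
  a (- k) = conjc (a k).
Proof.
move=> ar kN.
have aJ x : FS (fun j => conjc (a (- j))) x = FS a x.
  by rewrite -fourier_sum_conj; case: (FS a x) (ar x) => u v /= ->; rewrite oppr0.
rewrite -[a k](cint_delta_fourier_sum a kN).
have -> : (fun x => FS a x * FS (fun j => (j == - k)%:R) x) =
    (fun x => FS (fun j => conjc (a (- j))) x * FS (fun j => (j == - k)%:R) x).
  by apply/funext => x; rewrite aJ.
by rewrite (cint_delta_fourier_sum (fun j => conjc (a (- j))) kN) conjcK.
Qed.

End FourierSums.

(** * The sup norm of the field and the scaling *)

Section SupNorm.
Context {R : realType}.
Local Notation mu := (@lebesgue_measure R).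
Variables (L : R) (Nx : nat).
Hypothesis L_gt0 : 0 < L.
Implicit Types (a b : int -> R[i]).

Local Notation freq := (@frequency Nx).
Local Notation FS := (fourier_sum L Nx).

(** An l^1 norm of the coefficients, weighted by the constant modulus of the modes. It is the
    Lipschitz bound through which time regularity passes from the coefficients to the sup norm. *)
Definition coef_bound a : R :=
  \sum_(i < Nx.*2.+1) Normc.normc (a (freq i)) / Num.sqrt L.

Lemma normc_fourier j x : Normc.normc (fourier L j x) = (Num.sqrt L)^-1.
Proof.
rewrite /fourier Normc.normcM /Normc.normc /= cos2Dsin2 sqrtr1 mulr1.
by rewrite expr0n /= addr0 sqrtr_sqr ger0_norm// invr_ge0 sqrtr_ge0.
Qed.

Lemma normc_fourier_sum_le a x : Normc.normc (FS a x) <= coef_bound a.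
Proof.
rewrite /fourier_sum /coef_bound; elim/big_ind2 : _ => //.
- by rewrite Normc.normc0.
- by move=> u p v q up vq; apply: le_trans (le_normcD _ _) _; exact: lerD.
- by move=> i _; rewrite Normc.normcM normc_fourier.
Qed.

Lemma sup_norm_has_sup a : has_sup [set Normc.normc (FS a x) | x in `]0, L[].
Proof.
split; last by exists (coef_bound a) => _ [x _ <-]; exact: normc_fourier_sum_le.
exists (Normc.normc (FS a (L / 2))); exists (L / 2) => //=.
by rewrite in_itv/= divr_gt0//= ltr_pdivrMr// ltr_pMr// ltr1n.
Qed.

Lemma normc_le_sup_norm a x : x \in `]0, L[ ->
  Normc.normc (FS a x) <= sup_norm L (FS a).
Proof.
move=> xL; apply: sup_upper_bound; first exact: sup_norm_has_sup.
by exists x.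
Qed.

Lemma sup_norm_le (u : R -> R[i]) (M : R) :
  (forall x, x \in `]0, L[ -> Normc.normc (u x) <= M) -> sup_norm L u <= M.
Proof.
move=> uM; apply: ge_sup; last by move=> _ [x xL <-]; exact: uM.
exists (Normc.normc (u (L / 2))); exists (L / 2) => //=.
by rewrite in_itv/= divr_gt0//= ltr_pdivrMr// ltr_pMr// ltr1n.
Qed.

Lemma sup_norm_subr_le a b :
  sup_norm L (FS a) - sup_norm L (FS b) <= coef_bound (fun j => a j - b j).
Proof.
rewrite lerBlDr; apply: sup_norm_le => x xL.
have -> : FS a x = FS (fun j => a j - b j) x + FS b x.
  by rewrite /fourier_sum -big_split /=; apply: eq_bigr => i _; rewrite -mulrDl subrK.
apply: le_trans (le_normcD _ _) _; apply: lerD; first exact: normc_fourier_sum_le.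
exact: normc_le_sup_norm.
Qed.

Lemma coef_boundN a : coef_bound (fun j => - a j) = coef_bound a.
Proof. by apply: eq_bigr => i _; rewrite normcN. Qed.

Lemma sup_norm_dist a b :
  `|sup_norm L (FS a) - sup_norm L (FS b)| <= coef_bound (fun j => a j - b j).
Proof.
rewrite ler_norml sup_norm_subr_le andbT lerNl opprB.
rewrite -coef_boundN; apply: le_trans (sup_norm_subr_le _ _) _.
by rewrite le_eqVlt; apply/orP; left; apply/eqP; apply: eq_bigr => i _; rewrite opprB.
Qed.

Lemma normc_le_ReIm (z : R[i]) :
  Normc.normc z <= `|complex.Re z| + `|complex.Im z|.
Proof.
case: z => u v /=; rewrite -[leRHS]ger0_norm ?addr_ge0// -sqrtr_sqr.
rewrite ler_wsqrtr// sqrrD !real_normK ?num_real//.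
by rewrite lerD2r lerDl mulrn_wge0// mulr_ge0.
Qed.

End SupNorm.

(** * Primitives of functions continuous on the half-line *)

Section PrimitiveFromZero.
Context {R : realType}.
Local Notation mu := (@lebesgue_measure R).

(** The map [s |-> max s 0] is continuous into the half-line, so composing with it freezes [g] at
    [g 0] on negative times and allows two-sided calculus. *)
Lemma continuous_extension (g : R -> R) :
  (forall t : R, 0 <= t -> g s @[s --> within `[0, +oo[ (nbhs t)] --> g t) ->
  continuous (fun s : R => g (Num.max s 0)).
Proof.
move=> gc t; have m0 : 0 <= Num.max t 0 by rewrite le_max lexx orbT.
apply: (@cvg_comp _ _ _ (fun s : R => Num.max s 0) g _ _ _ _ (gc _ m0)) => A.
rewrite /within /= => tA.
have mc : {for t, continuous (fun s : R => Num.max s 0)}.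
  by apply: (@continuous_max _ _ (fun s => s) (fun=> 0));
    [exact: cvg_id|exact: cvg_cst].
have := mc _ tA; rewrite /fmap /=; apply: (@filterS _ (nbhs t)) => s; apply.
by rewrite in_itv/= andbT le_max lexx orbT.
Qed.

Lemma has_dt_primitive (g : R -> R) (t : R) :
  (forall s : R, 0 <= s -> g u @[u --> within `[0, +oo[ (nbhs s)] --> g s) ->
  0 <= t -> has_dt (fun s => \int[mu]_(u in `[0, s]) g u) t (g t).
Proof.
move=> gc t0; pose h (s : R) := g (Num.max s 0).
have hc : continuous h by exact: continuous_extension.
have ih a b : mu.-integrable `[a, b] (EFin \o h).
  apply: continuous_compact_integrable; first exact: segment_compact.
  exact: continuous_subspaceT.
(* The base point is moved to -1: the two-sided FTC then applies at 0. *)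
pose F s := \int[mu]_(u in `[-1, s]) h u.
have dF : is_derive t 1 F (h t).
  have lt1 : t < t + 1 by rewrite ltrDl.
  have ltN : -1 < t by rewrite (lt_le_trans _ t0)// ltrN10.
  have [dF dFE] := continuous_FTC1_closed lt1 (ih _ _) ltN (hc t).
  by rewrite -dFE derive1E; exact: derivableP.
have -> : g t = h t by rewrite /h max_l.
have dF0 := has_dtD (is_derive_has_dt dF) (has_dt_cst (- F 0) t).
rewrite addr0 in dF0; apply: has_dt_congr dF0 => // s s0.
rewrite /F Rintegral_itvB//; last by rewrite bnd_simp lerN10.
rewrite Rintegral_itv_obnd_cbnd; last first.
  by apply: (@integrableS _ _ _ mu `[0, s]) => //; exact: subset_itv_oc_cc.
by apply: eq_Rintegral => u; rewrite inE/= in_itv/= => /andP[u0 _]; rewrite /h max_l.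
Qed.

End PrimitiveFromZero.

(** * Time regularity of the field norm and of [alpha] *)

Section Scale.
Context {R : realType}.
Local Notation mu := (@lebesgue_measure R).
Variables (L alpha0 gamma : R) (Nx : nat) (Ec : int -> R -> R[i]).
Hypotheses (L_gt0 : 0 < L) (alpha0_gt0 : 0 < alpha0) (gamma_gt0 : 0 < gamma).
Hypothesis Ec_derivable : forall j (t : R), `|j| <= Nx%:Z -> 0 <= t ->
  exists l, has_cdt (Ec j) t l.

Local Notation freq := (@frequency Nx).
Local Notation E := (electric_field L Nx Ec).
Local Notation al := (alpha L alpha0 gamma Nx Ec).
Local Notation e := (fun t => sup_norm L (E t)).

Lemma sup_norm_field_cvg (t : R) : 0 <= t ->
  e s @[s --> within `[0, +oo[ (nbhs t)] --> e t.
Proof.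
move=> t0; pose F := within `[0, +oo[ (nbhs t).
(* This is the coefficient bound with the modulus replaced by [|Re| + |Im|], because the continuity
   of the coefficients is known componentwise. *)
pose D s := \sum_(i < Nx.*2.+1)
  (`|complex.Re (Ec (freq i) s) - complex.Re (Ec (freq i) t)|
   + `|complex.Im (Ec (freq i) s) - complex.Im (Ec (freq i) t)|) / Num.sqrt L.
have Dc : D s @[s --> F] --> 0.
  rewrite (_ : 0 = \sum_(i < Nx.*2.+1) (0 : R)); last by rewrite big1.
  rewrite /D; apply: cvg_big => [|i _]; first exact: add_continuous.
  rewrite -(mul0r (Num.sqrt L)^-1); apply: cvgM; last exact: cvg_cst.
  have [l [/has_dt_continuous Rc /has_dt_continuous Ic]] :=
    Ec_derivable (frequency_bound i) t0.
  rewrite -(addr0 0); apply: cvgD; rewrite -(normr0 R); apply: cvg_norm.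
    by rewrite -(subrr (complex.Re (Ec (freq i) t))); apply: cvgB Rc (cvg_cst _).
  by rewrite -(subrr (complex.Im (Ec (freq i) t))); apply: cvgB Ic (cvg_cst _).
have eD s : `|e s - e t| <= D s.
  apply: le_trans (sup_norm_dist Nx L_gt0 (Ec ^~ s) (Ec ^~ t)) _.
  apply: ler_sum => i _; rewrite ler_wpM2r ?invr_ge0 ?sqrtr_ge0//.
  apply: le_trans (normc_le_ReIm _) _.
  by case: (Ec _ s) (Ec _ t) => [? ?] [? ?].
have h : e s - e t @[s --> F] --> 0.
  apply: norm_cvg0; apply: (@squeeze_cvgr _ _ _ _ (fun=> 0) D) => //.
    by near=> s; rewrite normr_ge0 eD.
  exact: cvg_cst.
rewrite -[e t]add0r; apply: cvg_trans (cvgD h (cvg_cst (e t))).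
by apply: near_eq_cvg; near=> s; rewrite /= subrK.
Unshelve. all: by end_near. Qed.

Definition field_action t :=
  1 + gamma * \int[mu]_(s in `[0, t]) (sup_norm L (E s)) ^+ 2.

Lemma field_action_gt0 t : 0 < field_action t.
Proof.
rewrite /field_action ltr_wpDr// mulr_ge0 ?(ltW gamma_gt0)//.
by apply: Rintegral_ge0 => s _; rewrite sqr_ge0.
Qed.

Lemma alphaE t : al t = alpha0 / Num.sqrt (field_action t).
Proof. by []. Qed.

Lemma alpha_gt0 t : 0 < al t.
Proof. by rewrite alphaE divr_gt0// sqrtr_gt0 field_action_gt0. Qed.

(** Write [A] for [field_action]. Differentiating [alpha0 * A^(-1/2)] with [A' = gamma * e^2] leaves
    [A^(-3/2)], which is expressed through [A^(-1/2) = alpha / alpha0]. *)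
Definition dalpha t := - (gamma * (al t) ^+ 3 * (e t) ^+ 2 / (2 * alpha0 ^+ 2)).

Lemma has_dt_alpha (t : R) : 0 <= t -> has_dt al t (dalpha t).
Proof.
move=> t0.
have dA : has_dt field_action t (gamma * (e t) ^+ 2).
  rewrite -[X in has_dt _ _ X]add0r; apply: has_dtD; first exact: has_dt_cst.
  apply: has_dtZ; apply: (@has_dt_primitive _ (fun s => (e s) ^+ 2)) => // s s0.
  by apply: cvgM; exact: sup_norm_field_cvg.
have q0 : 0 < Num.sqrt (field_action t) by rewrite sqrtr_gt0 field_action_gt0.
have dq := has_dt_sqrt t0 (fun s _ => field_action_gt0 s) dA.
have := has_dtV (f := fun s => Num.sqrt (field_action s)) (lt0r_neq0 q0) dq.
move=> /(@has_dtZ _ _ _ _ alpha0); apply: has_dt_eq => //; rewrite /dalpha alphaE; field.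
by rewrite (lt0r_neq0 q0) (lt0r_neq0 alpha0_gt0).
Qed.

Lemma dt_alpha (t : R) : 0 <= t -> dt al t = dalpha t.
Proof. by move=> t0; apply: dtE => //; exact: has_dt_alpha. Qed.

Lemma sup_norm_field_bounded (T : R) : 0 < T ->
  exists2 CT : R, 0 < CT & forall t : R, 0 <= t <= T -> sup_norm L (E t) <= CT.
Proof.
move=> T0; have ec : {within `[0, T], continuous e}.
  apply/subspace_continuousP => x /=; rewrite in_itv/= => /andP[x0 _].
  apply: cvg_trans (sup_norm_field_cvg x0); apply: cvg_app => A.
  rewrite /within/=; apply: (@filterS _ (nbhs x)) => s As sb; apply: As.
  by move: sb; rewrite !in_itv/= andbT => /andP[].
have [c _ cmax] := EVT_max (ltW T0) ec.
(* Here [c] is a maximum point of the field norm; the [+ 1] keeps the constant positive when the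
   field vanishes. *)
exists (`|e c| + 1); first by rewrite ltr_wpDl.
move=> t tT; apply: (@le_trans _ _ (e c)); first by apply: cmax; rewrite in_itv.
by apply: le_trans (ler_norm _) _; rewrite lerDl.
Qed.

End Scale.

(** * Hermite polynomials and Gaussian moments *)

Section HermitePolynomials.
Context {R : realType}.

(** A formal copy of [hermite], so that derivatives and products are computed in the polynomial
    ring. *)
Fixpoint hermite_poly (n : nat) : {poly R} :=
  if n is m.+1 then
    (Num.sqrt (m.+1)%:R)^-1 *: ('X * hermite_poly m
     - Num.sqrt m%:R *: (if m is k.+1 then hermite_poly k else 0))
  else 1.

Lemma hermite_polyE n x : (hermite_poly n).[x] = hermite n x.
Proof.
suff : (hermite_poly n).[x] = hermite n x /\
    (hermite_poly n.+1).[x] = hermite n.+1 x by case.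
elim: n => [|n [ih1 ih2]].
  split; first by rewrite /= hornerC.
  by rewrite /= !hornerE /= mulrC.
split=> //.
have -> : hermite_poly n.+2 = (Num.sqrt (n.+2)%:R)^-1 *: ('X * hermite_poly n.+1
     - Num.sqrt n.+1%:R *: hermite_poly n) by [].
have -> : hermite n.+2 x = (x * hermite n.+1 x
     - Num.sqrt n.+1%:R * hermite n x) / Num.sqrt (n.+2)%:R by [].
by rewrite hornerZ hornerD hornerN hornerZ hornerM hornerX ih1 ih2 mulrC.
Qed.

Lemma sqrtS_neq0 n : Num.sqrt (n.+1)%:R != 0 :> R.
Proof. by rewrite gt_eqF// sqrtr_gt0. Qed.

Lemma hermite_poly_rec n : Num.sqrt (n.+2)%:R *: hermite_poly n.+2 =
  'X * hermite_poly n.+1 - Num.sqrt (n.+1)%:R *: hermite_poly n.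
Proof. by rewrite {1}/hermite_poly -/hermite_poly scalerA divff ?scale1r ?sqrtS_neq0. Qed.

Lemma hermite_poly1 : hermite_poly 1 = 'X.
Proof. by rewrite /= scaler0 subr0 mulr1 sqrtr1 invr1 scale1r. Qed.

Lemma deriv_hermite_poly0 : (hermite_poly 0)^`() = 0.
Proof. by rewrite /= -polyC1 derivC. Qed.

Lemma deriv_hermite_poly n :
  (hermite_poly n.+1)^`() = Num.sqrt (n.+1)%:R *: hermite_poly n.
Proof.
suff : (hermite_poly n.+1)^`() = Num.sqrt (n.+1)%:R *: hermite_poly n /\
  (hermite_poly n.+2)^`() = Num.sqrt (n.+2)%:R *: hermite_poly n.+1 by case.
have sqE k : Num.sqrt k%:R * Num.sqrt k%:R = k%:R :> R.
  by rewrite -expr2 sqr_sqrtr.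
elim: n => [|n [ih1 ih2]].
  split; first by rewrite hermite_poly1 derivX /= sqrtr1 scale1r.
  apply: (scalerI (sqrtS_neq0 1)); rewrite -derivZ hermite_poly_rec hermite_poly1.
  rewrite scalerA sqE derivB derivM derivX mul1r mulr1 derivZ deriv_hermite_poly0.
  by rewrite scaler0 subr0 scaler_nat mulr2n.
split => //.
apply: (scalerI (sqrtS_neq0 n.+2)); rewrite -derivZ hermite_poly_rec.
rewrite derivB derivM ih2 derivX mul1r derivZ ih1 [RHS]scalerA sqE.
(* Differentiating the recurrence gives one copy of [hermite_poly n.+2] from the factor ['X]; by the
   two induction hypotheses the remaining terms form the recurrence again, worth [n + 2] further
   copies. *)
have key : Num.sqrt (n.+2)%:R *: ('X * hermite_poly n.+1
    - Num.sqrt (n.+1)%:R *: hermite_poly n) = n.+2%:R *: hermite_poly n.+2.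
  by rewrite -hermite_poly_rec scalerA sqE.
rewrite -(natr1 n.+2) scalerDl scale1r -key scalerBr scalerAr.
by rewrite -addrA addrC.
Qed.

End HermitePolynomials.

(** * Gaussian integrals of polynomials and orthogonality *)

Section GaussianMoments.
Context {R : realType}.
Local Notation mu := (@lebesgue_measure R).

(** By dominated convergence, with [|f|] as dominating function, the integral is the limit of the
    integrals over []-n, n[], and these are boundary terms of [F]. *)
Lemma integral_derivative_eq0 (f F : R -> R) : continuous f ->
  (forall x : R, is_derive x 1 F (f x)) -> mu.-integrable setT (EFin \o f) ->
  F n%:R - F (- n%:R) @[n --> \oo] --> (0 : R) -> \int[mu]_x f x = 0.
Proof.
move=> cf dF fi F0.
pose D n : set R := `]- n%:R, n%:R[%classic.
have mf := measurable_int mu fi.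
have h : (\int[mu]_x ((EFin \o f) \_ (D n)) x)%E @[n --> \oo] -->
    (\int[mu]_x (EFin \o f) x)%E.
  apply: (@dominated_cvg _ _ _ mu setT measurableT _ _ (fun x => `|(f x)%:E|)%E).
  - move=> n; apply/(measurable_restrictT _ _).1.
    exact: measurable_itv.
    exact: measurable_funTS.
  - move=> x _; apply: (@cvg_trans _ ((fun _ : nat => (f x)%:E) @ \oo)).
      apply: near_eq_cvg; near=> n; rewrite patchE ifT//.
      rewrite inE /D /= in_itv/= -ltr_norml.
      by near: n; exact: nbhs_infty_gtr.
    exact: cvg_cst.
  - by move=> x _.
  - exact: integrable_abse.
  - move=> n x _; rewrite patchE; case: ifP => // _.
    by rewrite /= normr0 lee_fin.
have hE n : (0 < n)%N ->
    (\int[mu]_x ((EFin \o f) \_ (D n)) x)%E = (F n%:R - F (- n%:R))%:E.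
  move=> n0; rewrite -integral_mkcond.
  have nn : - n%:R < n%:R :> R by rewrite (@lt_trans _ _ 0)// ?oppr_lt0 ltr0n.
  rewrite -(Rintegral_FTC2 nn cf dF) /Rintegral fineK//.
  apply: (@integrable_fin_num _ _ _ mu) => //.
  exact: continuous_integrable_oo.
have h0 : (\int[mu]_x ((EFin \o f) \_ (D n)) x)%E @[n --> \oo] --> 0%E.
  have hF : (F n%:R - F (- n%:R))%:E @[n --> \oo] --> 0%:E.
    by apply: cvg_EFin => //; exact: nearW.
  apply: cvg_trans hF.
  by apply: near_eq_cvg; near=> n; rewrite hE//; near: n; exact: nbhs_infty_gt.
by rewrite /Rintegral (cvg_unique _ h h0).
Unshelve. all: by end_near. Qed.

(** With [z = x^2 / 4], one has [|x|^i <= 1 + x^(2i) = 1 + 4^i z^i] and [z^i <= i! e^z]; this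
    explains the factor [4 ^+ i * i!]. *)
Definition poly_bound (p : {poly R}) : R :=
  \sum_(i < size p) `|p`_i| * (1 + 4 ^+ i * i`!%:R).

Lemma poly_bound_ge0 p : 0 <= poly_bound p.
Proof. by apply: sumr_ge0 => i _; rewrite mulr_ge0// addr_ge0// mulr_ge0// exprn_ge0. Qed.

Lemma horner_le_expR (p : {poly R}) x :
  `|p.[x]| <= poly_bound p * expR (x ^+ 2 / 4).
Proof.
rewrite horner_coef /poly_bound mulr_suml.
apply: le_trans (ler_norm_sum _ _ _) _; apply: ler_sum => i _.
rewrite normrM -mulrA ler_wpM2l// normrX.
move: (nat_of_ord i) => k.
pose z := x ^+ 2 / 4; have x2 : x ^+ 2 = 4 * z by rewrite /z; field.
have z0 : 0 <= z by rewrite divr_ge0// sqr_ge0.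
have e1 : 1 <= expR z by rewrite -[leLHS]expR0 ler_expR.
have h1 : `|x| ^+ k <= 1 + (x ^+ 2) ^+ k.
  rewrite -(real_normK (num_real x)) -exprM mulnC exprM.
  by have : 0 <= `|x| ^+ k by []; nra.
apply: le_trans h1 _; rewrite -/z x2 [leRHS]mulrDl mul1r lerD//.
rewrite [leLHS]exprMn -[leRHS]mulrA ler_wpM2l ?exprn_ge0//.
case: k => [|k]; first by rewrite expr0 fact0 mul1r.
have h := expR_ge1Dxn k z0; rewrite mulrC -ler_pdivrMr ?ltr0n ?fact_gt0//.
by apply: le_trans h; rewrite lerDr.
Qed.

Variable a : R.
Hypothesis a_gt0 : 0 < a.

Definition gauss (v : R) : R := expR (- (a * v) ^+ 2 / 2).

Definition gauss_moment (p : {poly R}) : R := \int[mu]_v (p.[a * v] * gauss v).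

(** Integrability and total mass are read off from the normal density, with [k = 2] for the Gaussian
    weight and [k = 4] for the function that dominates polynomials times this weight. *)
Lemma normal_pdf_expR (k v : R) : 0 < k ->
  normal_pdf 0 (Num.sqrt (k / 2) / a) v =
  (Num.sqrt (k * pi) / a)^-1 * expR (- (a * v) ^+ 2 / k).
Proof.
move=> k0.
have s0 : Num.sqrt (k / 2) / a != 0.
  by rewrite gt_eqF// divr_gt0// sqrtr_gt0 divr_gt0.
have sE : (Num.sqrt (k / 2) / a) ^+ 2 = k / 2 / a ^+ 2.
  by rewrite expr_div_n sqr_sqrtr// divr_ge0// ltW.
have a0 : a != 0 by rewrite gt_eqF.
rewrite normal_pdfE// /normal_peak /normal_fun sE subr0; congr (_ * expR _).
  have -> : k / 2 / a ^+ 2 * pi *+ 2 = k * pi * (a^-1) ^+ 2 by field.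
  rewrite sqrtrM; last by rewrite mulr_ge0 ?pi_ge0// ltW.
  by rewrite sqrtr_sqr ger0_norm// invr_ge0 ltW.
by field; rewrite a0 gt_eqF.
Qed.

Lemma integrable_gauss (k : R) : 0 < k ->
  mu.-integrable setT (EFin \o (fun v => expR (- (a * v) ^+ 2 / k))).
Proof.
move=> k0.
have c0 : Num.sqrt (k * pi) / a != 0.
  by rewrite gt_eqF// divr_gt0// sqrtr_gt0 mulr_gt0// pi_gt0.
have := integrableZl measurableT (Num.sqrt (k * pi) / a)
  (integrable_normal_pdf 0 (Num.sqrt (k / 2) / a)).
apply: eq_integrable => // v _ /=.
by rewrite normal_pdf_expR// -EFinM mulrA divff// mul1r.
Qed.

Lemma gauss_moment1 : gauss_moment 1 = Num.sqrt (2 * pi) / a.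
Proof.
have c0 : Num.sqrt (2 * pi) / a != 0.
  by rewrite gt_eqF// divr_gt0// sqrtr_gt0 mulr_gt0// pi_gt0.
have := integral_normal_pdf 0 (Num.sqrt (2 / 2) / a).
under eq_integral do rewrite normal_pdf_expR//.
move=> /(congr1 fine) /= h; rewrite /gauss_moment.
under eq_Rintegral do rewrite hornerC mul1r.
apply: (mulfI (x := (Num.sqrt (2 * pi) / a)^-1)); first by rewrite invr_eq0.
rewrite mulVf// -RintegralZl//; exact: integrable_gauss.
Qed.

(** Absorbing the polynomial costs half of the Gaussian exponent; the other half still gives
    integrability and decay at infinity. *)
Lemma horner_gauss_le (p : {poly R}) v :
  `|p.[a * v] * gauss v| <= poly_bound p * expR (- (a * v) ^+ 2 / 4).
Proof.
rewrite normrM (ger0_norm (expR_ge0 _)).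
have -> : expR (- (a * v) ^+ 2 / 4) =
    expR ((a * v) ^+ 2 / 4) * gauss v.
  by rewrite /gauss -expRD; congr expR; field.
by rewrite mulrA ler_wpM2r ?expR_ge0// horner_le_expR.
Qed.

Lemma is_derive_gauss (v : R) : is_derive v 1 gauss (- a * (a * v) * gauss v).
Proof.
pose q : {poly R} := (- a ^+ 2 / 2) *: 'X^2.
have -> : gauss = expR \o (horner q).
  by apply/funext => u /=; rewrite /gauss /q hornerZ hornerXn; congr expR; field.
have -> : - a * (a * v) * (expR \o horner q) v = expR (q.[v]) * (q^`()).[v].
  by rewrite mulrC /q derivZ derivXn hornerZ hornerMn expr1 hornerX /=; field.
exact: is_derive1_comp.
Qed.

Lemma is_derive_horner_gauss (p : {poly R}) (v : R) :
  is_derive v 1 (fun u => p.[a * u] * gauss u)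
    (a * ((p^`() - 'X * p).[a * v] * gauss v)).
Proof.
have dp : is_derive v 1 (fun u => p.[a * u]) ((p^`()).[a * v] * a).
  apply: (@is_derive1_comp _ (horner p) (fun u => a * u)).
  exact: is_derive1_mull.
have dg := is_derive_gauss v.
rewrite [X in is_derive _ _ X _](_ : _ = (fun u : R => p.[a * u]) * gauss)//.
apply: is_derive_eq; rewrite /GRing.scale /= hornerD hornerN hornerM hornerX; ring.
Qed.

Lemma continuous_horner_gauss (p : {poly R}) :
  continuous (fun v => p.[a * v] * gauss v).
Proof.
move=> v; apply/differentiable_continuous/derivable1_diffP.
by case: (is_derive_horner_gauss p v).
Qed.

Lemma integrable_horner_gauss (p : {poly R}) :
  mu.-integrable setT (EFin \o (fun v => p.[a * v] * gauss v)).
Proof.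
apply: (@le_integrable _ _ _ mu setT measurableT _
  (fun v => (poly_bound p)%:E * (expR (- (a * v) ^+ 2 / 4))%:E)%E).
- apply/measurable_EFinP; apply: continuous_measurable_fun.
  exact: continuous_horner_gauss.
- move=> v _ /=; rewrite lee_fin [leRHS]ger0_norm; first exact: horner_gauss_le.
  by rewrite mulr_ge0 ?poly_bound_ge0 ?expR_ge0.
- by apply: integrableZl => //; exact: integrable_gauss.
Qed.

Lemma gauss_momentD p q : gauss_moment (p + q) = gauss_moment p + gauss_moment q.
Proof.
rewrite /gauss_moment -RintegralD//; try exact: integrable_horner_gauss.
by apply: eq_Rintegral => v _; rewrite hornerD mulrDl.
Qed.

Lemma gauss_momentZ k p : gauss_moment (k *: p) = k * gauss_moment p.
Proof.
rewrite /gauss_moment -RintegralZl//; last exact: integrable_horner_gauss.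
by apply: eq_Rintegral => v _; rewrite hornerZ mulrA.
Qed.

Lemma gauss_momentB p q : gauss_moment (p - q) = gauss_moment p - gauss_moment q.
Proof. by rewrite gauss_momentD -scaleN1r gauss_momentZ mulN1r. Qed.

(** Integration by parts: the difference of the two integrands, multiplied by [a], is the derivative
    of [p.[a * v] * gauss v], which vanishes at infinity. *)
Lemma gauss_moment_stein p : gauss_moment ('X * p) = gauss_moment p^`().
Proof.
apply/esym/eqP; rewrite -subr_eq0 -gauss_momentB.
suff : a * gauss_moment (p^`() - 'X * p) == 0.
  by rewrite mulf_eq0 (gt_eqF a_gt0).
rewrite /gauss_moment -RintegralZl//; last exact: integrable_horner_gauss.
apply/eqP; apply: (@integral_derivative_eq0 _ (fun u => p.[a * u] * gauss u)).
- by move=> v; apply: cvgM; [exact: cvg_cst|exact: continuous_horner_gauss].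
- exact: is_derive_horner_gauss.
- rewrite (_ : _ \o _ =
    fun v => (a%:E * (((p^`() - 'X * p).[a * v] * gauss v)%R)%:E)%E)//.
  by apply: integrableZl => //; exact: integrable_horner_gauss.
(* The signs [s = 1] and [s = -1] treat both ends. From [e^(-y) <= 1 / y] with [y = (a n)^2 / 4],
   and [n <= n^2], the boundary values are at most [C / n]. *)
have h (s : R) : s ^+ 2 = 1 ->
    p.[a * (s * n%:R)] * gauss (s * n%:R) @[n --> \oo] --> (0 : R).
  move=> s1; pose C := poly_bound p * (4 / a ^+ 2).
  have hC n : (0 < n)%N -> `|p.[a * (s * n%:R)] * gauss (s * n%:R)| <= C * n%:R^-1.
    move=> n0; apply: le_trans (horner_gauss_le _ _) _.
    rewrite /C -mulrA ler_wpM2l ?poly_bound_ge0//.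
    rewrite mulNr expRN -[leRHS]invrK lef_pV2 ?posrE ?expR_gt0//; last first.
      by rewrite invr_gt0 !mulr_gt0// ?invr_gt0 ?exprn_gt0 ?ltr0n.
    apply: le_trans (expR_ge1Dx _).
    have -> : (a * (s * n%:R)) ^+ 2 = a ^+ 2 * n%:R ^+ 2.
      by rewrite !exprMn s1 mul1r.
    have n1 : 1 <= n%:R :> R by rewrite ler1n.
    rewrite -[leRHS]addr0 !invfM !invrK addr0 mulrC.
    have a2 : 0 <= a ^+ 2 / 4 by rewrite divr_ge0// sqr_ge0.
    have -> : a ^+ 2 * n%:R ^+ 2 / 4 = a ^+ 2 / 4 * n%:R ^+ 2 by ring.
    nra.
  apply: norm_cvg0; apply: (@squeeze_cvgr _ _ _ _ (fun=> 0) (fun n => C * n%:R^-1)).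
  - near=> n; rewrite normr_ge0 hC//.
    by near: n; exact: nbhs_infty_gt.
  - exact: cvg_cst.
  - rewrite -(mulr0 C); apply: cvgM; first exact: cvg_cst.
    apply/gtr0_cvgV0; last exact: cvgr_idn.
    by near=> n; rewrite ltr0n; near: n; exact: nbhs_infty_gt.
have h1 := h 1 (expr1n _ _); have h2 := h (-1) (etrans (sqrrN 1) (expr1n _ _)).
rewrite -(subrr 0); apply: cvgB; [move: h1|move: h2]; apply: cvg_trans;
  by apply: near_eq_cvg; near=> n; rewrite ?mul1r ?mulN1r.
Unshelve. all: by end_near. Qed.

(* Stein's identity and the recurrence reduce the indices [(n + 1, m + 1)] to
   [(n, m)], up to the factors [sqrt (m + 1)] and [sqrt (n + 1)]. *)
Lemma gauss_moment_hermite n m :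
  gauss_moment (hermite_poly n * hermite_poly m) =
  (n == m)%:R * (Num.sqrt (2 * pi) / a).
Proof.
(* By Stein's identity the term with ['X] has the moment of a derivative, and this cancels the other
   term of the recurrence. *)
have Hn0 k : gauss_moment (hermite_poly k.+1) = 0.
  apply: (mulfI (@sqrtS_neq0 R k)); rewrite mulr0 -gauss_momentZ.
  case: k => [|k].
    rewrite hermite_poly1 gauss_momentZ -[X in gauss_moment X]mulr1.
    rewrite gauss_moment_stein -[X in X^`()]/(hermite_poly 0) deriv_hermite_poly0.
    by rewrite -(scale0r 0) gauss_momentZ mul0r mulr0.
  rewrite hermite_poly_rec gauss_momentB gauss_moment_stein deriv_hermite_poly.
  by rewrite subrr.
elim: n m => [|n ih] [|m].
- by rewrite mulr1 gauss_moment1 mul1r.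
- by rewrite mul1r Hn0 mul0r.
- by rewrite mulr1 Hn0 mul0r.
apply: (mulfI (@sqrtS_neq0 R n)); rewrite -gauss_momentZ scalerAl.
have -> : gauss_moment (Num.sqrt n.+1%:R *: hermite_poly n.+1 * hermite_poly m.+1) =
    Num.sqrt m.+1%:R * gauss_moment (hermite_poly n * hermite_poly m).
  have dE : (hermite_poly m.+1)^`() = Num.sqrt m.+1%:R *: hermite_poly m :> {poly R}.
    exact: deriv_hermite_poly.
  case: n {ih} => [|n].
    rewrite sqrtr1 scale1r hermite_poly1 gauss_moment_stein dE gauss_momentZ.
    by rewrite mul1r.
  (* In the product rule, the term differentiating [hermite_poly n.+1] cancels the subtracted term
     of the recurrence; the other one is the right-hand side. *)
  rewrite hermite_poly_rec mulrBl gauss_momentB -mulrA gauss_moment_stein derivM.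
  rewrite deriv_hermite_poly dE gauss_momentD addrC addKr.
  by rewrite -scalerAr gauss_momentZ.
rewrite ih eqSS; case: eqP => [->//|_]; by rewrite !mul0r !mulr0.
Qed.

End GaussianMoments.

(** * The weighted norm *)

Section WeightedNorm.
Context {R : realType}.
Local Notation mu := (@lebesgue_measure R).
Variables (L alpha0 gamma : R) (Nx : nat) (Ec : int -> R -> R[i]).
Variables (NH : nat) (c : int -> int -> R -> R[i]).
Hypotheses (L_gt0 : 0 < L) (alpha0_gt0 : 0 < alpha0) (gamma_gt0 : 0 < gamma).

Local Notation al := (alpha L alpha0 gamma Nx Ec).
Local Notation C := (hermite_coef L Nx c).
Local Notation u n t x := (complex.Re (C n%:Z t x)).

Lemma FH_distribution_real t x v : (forall n, real_valued (C n t)) ->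
  FH_distribution L alpha0 gamma Nx Ec NH c t x v =
  (\sum_(n < NH) u n t x * Psi L alpha0 gamma Nx Ec n t v)%:C.
Proof.
move=> Cr; rewrite rmorph_sum /=; apply: eq_bigr => n _.
rewrite -mulr_suml [RHS]rmorphM; congr (_ * _).
transitivity (C n%:Z t x) => //.
by case: (C n%:Z t x) (Cr n%:Z x) => a b /= ->.
Qed.

Lemma gauss_moment_hermite_sqr (a : R) (w : nat -> R) : 0 < a ->
  gauss_moment a ((\sum_(n < NH) w n *: hermite_poly n) ^+ 2) =
  (\sum_(n < NH) w n ^+ 2) * (Num.sqrt (2 * pi) / a).
Proof.
move=> a0; have gsum (F : 'I_NH -> {poly R}) :
    gauss_moment a (\sum_(n < NH) F n) = \sum_(n < NH) gauss_moment a (F n).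
  elim/big_rec2 : _ => [|n y p _ <-]; last by rewrite gauss_momentD.
  by rewrite -(scale0r 0) gauss_momentZ// mul0r.
rewrite expr2 mulr_suml gsum mulr_suml; apply: eq_bigr => n _.
rewrite mulr_sumr gsum (bigD1 n)//= big1 ?addr0 => [|m mn].
  rewrite -scalerAl -scalerAr !gauss_momentZ// gauss_moment_hermite// eqxx.
  by rewrite mul1r expr2 mulrA.
rewrite -scalerAl -scalerAr !gauss_momentZ// gauss_moment_hermite//.
by rewrite eq_sym (inj_eq val_inj) (negbTE mn) mul0r !mulr0.
Qed.

(** In the variable [alpha v] the distribution is [alpha / sqrt (2 pi)] times a polynomial times the
    Gaussian, and the weight is [sqrt (2 pi)] over the Gaussian. Orthogonality gives back
    [sqrt (2 pi) / alpha], so a single factor [alpha] survives. *)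
Lemma integral_velocity t x : (forall n, real_valued (C n t)) ->
  (\int[mu]_v ((Normc.normc (FH_distribution L alpha0 gamma Nx Ec NH c t x v)) ^+ 2
    * weight L alpha0 gamma Nx Ec t v)%:E)%E =
  (al t * \sum_(n < NH) u n t x ^+ 2)%:E.
Proof.
move=> Cr; have a0 : 0 < al t by exact: alpha_gt0.
pose P : {poly R} := \sum_(n < NH) u n t x *: hermite_poly n.
have q0 : Num.sqrt (2 * pi) != 0 :> R.
  by rewrite gt_eqF// sqrtr_gt0 mulr_gt0// pi_gt0.
transitivity (\int[mu]_v ((al t ^+ 2 / Num.sqrt (2 * pi))
    * ((P ^+ 2).[al t * v] * gauss (al t) v))%:E)%E.
  apply: eq_integral => v _; congr EFin.
  rewrite FH_distribution_real// /Normc.normc /= expr0n /= addr0 sqrtr_sqr.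
  rewrite real_normK ?num_real//.
  have -> : \sum_(n < NH) u n t x * Psi L alpha0 gamma Nx Ec n t v =
      al t / Num.sqrt (2 * pi) * gauss (al t) v * P.[al t * v].
    rewrite /P horner_sum mulr_sumr; apply: eq_bigr => n _.
    rewrite hornerZ hermite_polyE /Psi /gauss; ring.
  rewrite /weight horner_exp.
  have -> : expR ((al t * v) ^+ 2 / 2) = (gauss (al t) v)^-1.
    by rewrite /gauss -expRN mulNr opprK.
  have g0 : gauss (al t) v != 0 by rewrite gt_eqF// expR_gt0.
  by field; rewrite g0 q0.
rewrite -[LHS]fineK.
  rewrite -/(Rintegral _ _ _) RintegralZl//; last exact: integrable_horner_gauss.
  rewrite [X in _ * X](_ : _ = gauss_moment (al t) (P ^+ 2))//.
  rewrite (gauss_moment_hermite_sqr (fun n => u n t x) a0); congr EFin.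
  by field; rewrite q0 gt_eqF.
apply: (@integrable_fin_num _ _ _ mu) => //.
have := @integrableZl _ _ _ mu _ measurableT (al t ^+ 2 / Num.sqrt (2 * pi)) _
  (integrable_horner_gauss a0 (P ^+ 2)).
by apply: eq_integrable.
Qed.

Lemma continuous_Re_coef (n : int) t : continuous (fun x => complex.Re (C n t x)).
Proof. by case: (ccontinuous_fourier_sum L Nx (fun j => c n j t)). Qed.

Lemma weighted_normE t : (forall n, real_valued (C n t)) ->
  weighted_norm L alpha0 gamma Nx Ec t (FH_distribution L alpha0 gamma Nx Ec NH c t) =
  (Num.sqrt (al t * \sum_(n < NH) \int[mu]_(x in `]0, L[) u n t x ^+ 2))%:E.
Proof.
move=> Cr; rewrite /weighted_norm.
under eq_integral do rewrite integral_velocity//.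
have uc (n : nat) : continuous (fun x => u n t x ^+ 2).
  by move=> x; apply: cvgM; exact: continuous_Re_coef.
have sc : continuous (fun x => \sum_(n < NH) u n t x ^+ 2).
  by apply: continuous_bigsum => n; exact: uc.
rewrite -[X in sqrte X]fineK.
  rewrite -/(Rintegral _ _ _) RintegralZl//; last exact: continuous_integrable_oo.
  rewrite /sqrte; congr (Num.sqrt (_ * _))%:E.
  by rewrite Rintegral_bigsum// => n; exact: uc.
apply: (@integrable_fin_num _ _ _ mu) => //.
apply: (continuous_integrable_oo (f := fun x => al t * \sum_(n < NH) u n t x ^+ 2)).
by move=> x; apply: cvgM; [exact: cvg_cst|exact: sc].
Qed.

End WeightedNorm.

(** * The dissipation inequality *)

Section ShiftedSums.
Context {R : nmodType}.

(** The vanishing at [N] and [N.+1] is the truncation of the Hermite expansion: shifting the level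
    creates no boundary term. *)
Lemma sum_shift_up (g : nat -> R) N :
  g 0%N = 0 -> g N.+1 = 0 -> g N = 0 ->
  \sum_(n < N.+1) g n.+1 = \sum_(n < N) g n.
Proof.
move=> g0 gN1 gN; transitivity (\sum_(n < N.+2) g n).
  by rewrite [RHS]big_ord_recl /= g0 add0r.
by rewrite !big_ord_recr /= gN gN1 !addr0.
Qed.

Lemma sum_shift_down (g : nat -> R) N :
  g 0%N = 0 -> \sum_(n < N.+1) g n = \sum_(n < N) g n.+1.
Proof. by move=> g0; rewrite big_ord_recl /= g0 add0r. Qed.

End ShiftedSums.

Section HermiteDissipation.
Context {R : realType}.

(* With [v_n = sqrt (n + 1) U_(n+1) + sqrt n U_(n-1)], the sum of the [v_n ^ 2] is
   twice the quadratic form on the left and the sum of the [U_n v_n] is twice the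
   field term. *)
Lemma hermite_dissipation (U : int -> R) (N : nat) (d p K : R) :
  (forall j, N%:Z <= j -> U j = 0) ->
  0 <= K -> 0 <= d -> p ^+ 2 <= 4 * d * K ->
  - d * \sum_(n < N) ((n%:R * U n%:Z
      + Num.sqrt ((n%:R - 1) * n%:R) * U (n%:Z - 2)) * U n%:Z + U n%:Z ^+ 2 / 2)
  + p * \sum_(n < N) Num.sqrt n%:R * U (n%:Z - 1) * U n%:Z
  <= K / 2 * \sum_(n < N) U n%:Z ^+ 2.
Proof.
move=> Uge K0 d0 pd.
pose v n : R := Num.sqrt n.+1%:R * U (n%:Z + 1) + Num.sqrt n%:R * U (n%:Z - 1).
have sq n : Num.sqrt n%:R ^+ 2 = n%:R :> R by rewrite sqr_sqrtr.
(* The range goes one step beyond the truncation because [v N = sqrt N * U_(N-1)] need not vanish,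
   although [U_N] does. *)
have vsq : \sum_(n < N.+1) v n ^+ 2 = 2 * \sum_(n < N) ((n%:R * U n%:Z
      + Num.sqrt ((n%:R - 1) * n%:R) * U (n%:Z - 2)) * U n%:Z + U n%:Z ^+ 2 / 2).
  transitivity (\sum_(n < N.+1) (n.+1%:R * U n.+1%:Z ^+ 2) +
      \sum_(n < N.+1) (n%:R * U (n%:Z - 1) ^+ 2) +
      \sum_(n < N.+1) (2 * (Num.sqrt ((n.+1%:R - 1) * n.+1%:R) *
        U (n.+1%:Z - 2) * U n.+1%:Z))).
    rewrite -!big_split /=; apply: eq_bigr => n _.
    have e1 : n.+1%:Z - 2 = n%:Z - 1 by lia.
    have e2 : n%:Z + 1 = n.+1%:Z by lia.
    have e3 : n.+1%:R - 1 = n%:R :> R by rewrite -natr1 addrK.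
    rewrite e3 sqrtrM// e1 /v e2.
    transitivity (Num.sqrt n.+1%:R ^+ 2 * U n.+1%:Z ^+ 2
      + Num.sqrt n%:R ^+ 2 * U (n%:Z - 1) ^+ 2
      + 2 * (Num.sqrt n%:R * Num.sqrt n.+1%:R * U (n%:Z - 1) * U n.+1%:Z)); first ring.
    by rewrite !sq.
  rewrite (@sum_shift_up _ (fun n => n%:R * U n%:Z ^+ 2)) ?mul0r//; last 2 first.
  - by rewrite Uge ?expr0n ?mulr0//; lia.
  - by rewrite Uge ?expr0n ?mulr0//; lia.
  rewrite (@sum_shift_down _ (fun n => n%:R * U (n%:Z - 1) ^+ 2)) ?mul0r//.
  rewrite (@sum_shift_up _ (fun n => 2 * (Num.sqrt ((n%:R - 1) * n%:R) *
    U (n%:Z - 2) * U n%:Z))); last 3 first.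
  - by rewrite mulr0 sqrtr0 !mul0r mulr0.
  - by rewrite (Uge N.+1%:Z) ?mulr0//; lia.
  - by rewrite (Uge N%:Z) ?mulr0.
  rewrite mulr_sumr -!big_split /=; apply: eq_bigr => n _.
  have -> : n.+1%:Z - 1 = n%:Z by lia.
  by rewrite -natr1; field.
have vU : \sum_(n < N.+1) U n%:Z * v n =
    2 * \sum_(n < N) Num.sqrt n%:R * U (n%:Z - 1) * U n%:Z.
  transitivity (\sum_(n < N.+1) (Num.sqrt n.+1%:R * U (n.+1%:Z - 1) * U n.+1%:Z) +
      \sum_(n < N.+1) (Num.sqrt n%:R * U (n%:Z - 1) * U n%:Z)).
    rewrite -!big_split /=; apply: eq_bigr => n _; rewrite /v.
    have -> : n.+1%:Z - 1 = n%:Z by lia.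
    have -> : n%:Z + 1 = n.+1%:Z by lia.
    ring.
  rewrite (@sum_shift_up _ (fun n => Num.sqrt n%:R * U (n%:Z - 1) * U n%:Z));
    last 3 first.
  - by rewrite sqrtr0 !mul0r.
  - by rewrite (Uge N.+1%:Z) ?mulr0//; lia.
  - by rewrite (Uge N%:Z) ?mulr0.
  by rewrite big_ord_recr /= (Uge N%:Z)// mulr0 addr0 mulr_natl mulr2n.
have UU : \sum_(n < N.+1) U n%:Z ^+ 2 = \sum_(n < N) U n%:Z ^+ 2.
  by rewrite big_ord_recr /= Uge// expr0n addr0.
(* The square [(2 d z - p w)^2] is completed after multiplication by [4 d]; for [d = 0] the
   condition on [p] forces [p = 0]. *)
have young (w z : R) : - d * z ^+ 2 + p * (w * z) <= K * w ^+ 2.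
  have [d00|dn0] := eqVneq d 0.
    have p0 : p = 0.
      apply/eqP; rewrite -sqrf_eq0 eq_le sqr_ge0 andbT.
      by move: pd; rewrite d00 mulr0 mul0r.
    by rewrite p0 d00 oppr0 !mul0r addr0 mulr_ge0// sqr_ge0.
  have d1 : 0 < d by rewrite lt_def dn0.
  have h0 : 0 <= (2 * d * z - p * w) ^+ 2 by exact: sqr_ge0.
  have h1 : 0 <= (4 * d * K - p ^+ 2) * w ^+ 2 by rewrite mulr_ge0 ?sqr_ge0// subr_ge0.
  rewrite -(ler_pM2l (mulr_gt0 (ltr0n _ 4) d1)); nra.
have : - d * \sum_(n < N.+1) v n ^+ 2 + p * \sum_(n < N.+1) U n%:Z * v n <=
    K * \sum_(n < N.+1) U n%:Z ^+ 2.
  rewrite !mulr_sumr -big_split /=; apply: ler_sum => n _; exact: young.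
rewrite vsq vU UU; lra.
Qed.

End HermiteDissipation.

(** * Conservation laws and stability *)

Section Solution.
Context {R : realType}.
Local Notation mu := (@lebesgue_measure R).
Variables (L alpha0 gamma : R) (NH Nx : nat).
Variables (c : int -> int -> R -> R[i]) (Ec : int -> R -> R[i]).
Variables (Phi : R -> R -> R[i]) (rho0 : R -> R).
Hypotheses (L_gt0 : 0 < L) (alpha0_gt0 : 0 < alpha0) (gamma_gt0 : 0 < gamma).
Hypothesis sol : FourierHermite_solution L alpha0 gamma Nx Ec NH c Phi rho0.
Implicit Types (a b : int -> R[i]) (t : R) (n : nat).

Local Notation freq := (@frequency Nx).
Local Notation FS := (fourier_sum L Nx).
Local Notation al := (alpha L alpha0 gamma Nx Ec).
Local Notation dal := (dalpha L alpha0 gamma Nx Ec).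
Local Notation E := (electric_field L Nx Ec).
Local Notation C := (hermite_coef L Nx c).
Local Notation kap := (wavenumber L).
Local Notation delta k := (fun j : int => (j == k)%:R : R[i]).

(** Bilinear rather than Hermitian, since the scheme tests without conjugation. For real functions
    [a_(-j)] is the conjugate of [a_j], so the pairing of [a] with itself is still a squared
    norm. *)
Definition pairing a b : R[i] := \sum_(i < Nx.*2.+1) a (freq i) * b (- freq i).

Lemma pairingE a b : pairing a b = cint L (fun x => FS a x * FS b x).
Proof. by rewrite cint_fourier_sumM. Qed.

Lemma pairingC a b : pairing a b = pairing b a.
Proof.
rewrite /pairing -(@sum_frequencyN Nx _ (fun j => a j * b (- j))).
by apply: eq_bigr => i _; rewrite opprK mulrC.
Qed.

(** Integration by parts on the periodic interval, in the form that [kap] is odd. *)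
Lemma pairing_wavenumber a b :
  pairing a (fun j => kap j * b j) = - pairing b (fun j => kap j * a j).
Proof.
rewrite [in RHS]/pairing.
rewrite -[in RHS](@sum_frequencyN Nx _ (fun j => b j * (kap (- j) * a (- j)))).
rewrite -sumrN; apply: eq_bigr => i _; rewrite opprK wavenumberN; ring.
Qed.

Lemma pairing_delta a k : `|k| <= Nx%:Z -> pairing a (delta (- k)) = a k.
Proof. by move=> kN; rewrite pairingE cint_delta_fourier_sum. Qed.

Lemma pairing_wavenumber_delta a k : `|k| <= Nx%:Z ->
  pairing a (fun j => kap j * delta (- k) j) = - (kap k * a k).
Proof.
move=> kN; rewrite -(pairing_delta (fun j => - (kap j * a j)) kN).
by apply: eq_bigr => i _; rewrite wavenumberN; ring.
Qed.

Lemma c_zero n j t : (NH <= n)%N -> c n%:Z j t = 0.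
Proof. by move=> h; apply: (fh_convention sol); right; lia. Qed.

Lemma fourier_sum_eq0 a : (forall j, a j = 0) -> FS a = fun=> 0.
Proof.
move=> a0; apply/funext => x; rewrite /fourier_sum big1// => i _.
by rewrite a0 mul0r.
Qed.

Lemma pairing_eq0l a b : (forall j, a j = 0) -> pairing a b = 0.
Proof. by move=> a0; rewrite /pairing big1// => i _; rewrite a0 mul0r. Qed.

Lemma pairing_eq0r a b : (forall j, b j = 0) -> pairing a b = 0.
Proof. by move=> b0; rewrite pairingC pairing_eq0l. Qed.

Definition dc (n j : int) t : R[i] := cdt (c n j) t.
Definition dE (j : int) t : R[i] := cdt (Ec j) t.

Lemma has_cdt_c (n j : int) t : `|j| <= Nx%:Z -> 0 <= t -> has_cdt (c n j) t (dc n j t).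
Proof.
move=> jN t0; have [l cl] := fh_coef_derivable sol n jN t0.
by rewrite /dc (cdtE t0 cl).
Qed.

Lemma has_cdt_E j t : `|j| <= Nx%:Z -> 0 <= t -> has_cdt (Ec j) t (dE j t).
Proof.
move=> jN t0; have [l cl] := fh_field_derivable sol jN t0.
by rewrite /dE (cdtE t0 cl).
Qed.

Lemma has_cdt_pairing (a b : int -> R -> R[i]) (a' b' : int -> R[i]) t :
  (forall j, `|j| <= Nx%:Z -> has_cdt (a j) t (a' j)) ->
  (forall j, `|j| <= Nx%:Z -> has_cdt (b j) t (b' j)) ->
  has_cdt (fun s => pairing (a ^~ s) (b ^~ s)) t
    (pairing a' (b ^~ t) + pairing (a ^~ t) b').
Proof.
move=> aa' bb'; rewrite /pairing -big_split /=.
apply: has_cdt_sum => i; apply: has_cdtM; first exact/aa'/frequency_bound.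
by apply: bb'; rewrite normrN frequency_bound.
Qed.

Lemma al_gt0 t : 0 < al t.
Proof. exact: alpha_gt0. Qed.

Lemma has_dt_al t : 0 <= t -> has_dt al t (dal t).
Proof. exact: has_dt_alpha (fh_field_derivable sol) _. Qed.

(** The field term stays an integral: the product of [E] and [C_(n-1)] may have frequencies beyond
    [Nx], so it is not itself a sum over the coefficient range. *)
Lemma vlasov_pairing n t b : (n < NH)%N -> 0 <= t ->
  pairing (fun j => dc n%:Z j t) b =
  (dal t / al t)%:C * (n%:R * pairing (fun j => c n%:Z j t) b +
    (Num.sqrt ((n%:R - 1) * n%:R))%:C * pairing (fun j => c (n%:Z - 2) j t) b)
  + ((al t)^-1)%:C * (
    (Num.sqrt n%:R)%:C * pairing (fun j => c (n%:Z - 1) j t) (fun j => kap j * b j) +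
    (Num.sqrt n.+1%:R)%:C * pairing (fun j => c (n%:Z + 1) j t) (fun j => kap j * b j))
  + (al t * Num.sqrt n%:R)%:C * cint L (fun x => E t x * C (n%:Z - 1) t x * FS b x).
Proof.
move=> nH t0; have VF : VNx L Nx (FS b) by exists b.
have := fh_vlasov sol nH t0 VF.
rewrite (dt_alpha L_gt0 alpha0_gt0 gamma_gt0 (fh_field_derivable sol) t0).
have cc a := ccontinuous_fourier_sum L Nx a.
have -> : (fun s => cint L (fun x => C n s x * FS b x)) =
    (fun s => pairing (fun j => c n%:Z j s) b).
  by apply/funext => s; rewrite pairingE.
have d := has_cdt_pairing (fun j jN => has_cdt_c n jN t0)
  (fun j _ => has_cdt_cst (b j) t).
rewrite (pairing_eq0r _ (b := fun=> 0))// addr0 in d.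
rewrite (cdtE t0 d).
have -> : cint L (fun x => (n%:R * C n t x
      + (Num.sqrt ((n%:R - 1) * n%:R))%:C * C (n%:Z - 2) t x) * FS b x) =
    n%:R * pairing (fun j => c n%:Z j t) b +
    (Num.sqrt ((n%:R - 1) * n%:R))%:C * pairing (fun j => c (n%:Z - 2) j t) b.
  rewrite !pairingE -!cintZ; try by apply: ccontinuousM; exact: cc.
  rewrite -cintD; try by apply: ccontinuousZ; apply: ccontinuousM; exact: cc.
  by congr cint; apply/funext => x; rewrite mulrDl !mulrA.
have -> : cint L (fun x => ((Num.sqrt n%:R)%:C * C (n%:Z - 1) t x
      + (Num.sqrt n.+1%:R)%:C * C (n%:Z + 1) t x) * cdx (FS b) x) =
    (Num.sqrt n%:R)%:C * pairing (fun j => c (n%:Z - 1) j t) (fun j => kap j * b j) +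
    (Num.sqrt n.+1%:R)%:C * pairing (fun j => c (n%:Z + 1) j t) (fun j => kap j * b j).
  rewrite cdx_fourier_sum !pairingE -!cintZ; try by apply: ccontinuousM; exact: cc.
  rewrite -cintD; try by apply: ccontinuousZ; apply: ccontinuousM; exact: cc.
  by congr cint; apply/funext => x; rewrite mulrDl !mulrA.
by move=> h; apply/eqP; rewrite -subr_eq0; apply/eqP; rewrite -[RHS]h; ring.
Qed.

Lemma freq0_bound : `|0 : int| <= Nx%:Z. Proof. by []. Qed.

Lemma fourier_sum_delta0 x : FS (delta 0) x = ((Num.sqrt L)^-1)%:C.
Proof. by rewrite fourier_sum_delta// fourier0. Qed.

Lemma dc0E k t : `|k| <= Nx%:Z -> 0 <= t ->
  dc 0 k t = - ((al t)^-1)%:C * (kap k * c 1 k t).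
Proof.
move=> kN t0; have [NH0|NH0] := posnP NH.
  have c0 n j : c n%:Z j = fun=> 0 by apply/funext => s; apply: c_zero; rewrite NH0.
  have -> : dc 0 k t = 0 by rewrite /dc c0 (cdtE t0 (has_cdt_cst 0 t)).
  by rewrite c0 !mulr0.
have := vlasov_pairing (delta (- k)) NH0 t0.
rewrite !pairing_delta// !pairing_wavenumber_delta// => ->.
rewrite !mulr0n !mulr0 !sqrtr0 sqrtr1 rmorph0 rmorph1 !mul0r !add0r mul1r.
by rewrite !mulr0 rmorph0 mul0r addr0 add0r mulrN mulNr.
Qed.

(** Tested with the constant mode, the potential equation says that the field has mean zero, because
    the derivative of the test function vanishes. *)
Lemma field_coef0 t : 0 <= t -> Ec 0 t = 0.
Proof.
move=> t0; have := fh_poisson_potential sol t0 (eta := FS (delta (- 0))).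
move=> /(_ (ex_intro _ _ erefl)); rewrite -pairingE pairing_delta// => <-.
rewrite cdx_fourier_sum (_ : (fun j => kap j * _) = fun=> 0); last first.
  by apply/funext => j; have [->|_] := eqVneq j (- 0);
    rewrite ?oppr0 ?wavenumber0 ?mul0r ?mulr0.
rewrite fourier_sum_eq0//.
have -> : (fun x => Phi t x * 0) = FS (fun=> 0).
  by apply/funext => x; rewrite mulr0 fourier_sum_eq0.
have -> : FS (fun=> 0) = fun x => FS (fun=> 0) x * FS (fun=> 0) x.
  by apply/funext => x; rewrite fourier_sum_eq0// mulr0.
by rewrite -pairingE pairing_eq0l.
Qed.

(** For [k <> 0] the test mode has mean zero, so the background density [rho0] drops out. *)
Lemma field_coefE k t : `|k| <= Nx%:Z -> k != 0 -> 0 <= t ->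
  kap k * Ec k t = c 0 k t.
Proof.
move=> kN k0 t0; have := fh_poisson_field sol t0 (zeta := FS (delta (- k))).
move=> /(_ (ex_intro _ _ erefl)); rewrite cdx_fourier_sum -pairingE.
rewrite pairing_wavenumber_delta// opprK => ->.
have cc a := ccontinuous_fourier_sum L Nx a.
have -> : (fun x => (C 0 t x - (rho0 t)%:C) * FS (delta (- k)) x) =
    (fun x => C 0 t x * FS (delta (- k)) x + (- (rho0 t)%:C) * FS (delta (- k)) x).
  by apply/funext => x; rewrite mulrDl.
rewrite cintD; [|by apply: ccontinuousM; exact: cc|by apply: ccontinuousZ; exact: cc].
rewrite -pairingE pairing_delta// cintZ; last exact: cc.
have -> : FS (delta (- k)) = fourier L (- k).
  by apply/funext => x; rewrite fourier_sum_delta// normrN.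
by rewrite cint_fourier// oppr_eq0 (negbTE k0) mulr0 addr0.
Qed.

(** The density may be replaced by [kap * E]: at frequency 0, where this fails in general, the
    factor [E_0 = 0] hides the difference. By antisymmetry the pairing of [E] with [kap * E] is its
    own opposite. *)
Lemma pairing_field_density t : 0 <= t ->
  pairing (fun j => Ec j t) (fun j => c 0 j t) = 0.
Proof.
move=> t0.
have h : pairing (fun j => Ec j t) (fun j => c 0 j t) =
    pairing (fun j => Ec j t) (fun j => kap j * Ec j t).
  apply: eq_bigr => i _; have [i0|i0] := eqVneq (freq i) 0.
    by rewrite i0 field_coef0// !mul0r.
  by rewrite field_coefE// ?normrN ?frequency_bound// oppr_eq0.
apply/eqP; rewrite h; have /eqP := pairing_wavenumber (fun j => Ec j t) (fun j => Ec j t).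
by rewrite -addr_eq0 -mulr2n mulrn_eq0.
Qed.

Lemma cint_field_delta0 (n : int) t :
  cint L (fun x => E t x * C n t x * FS (delta 0) x) =
  ((Num.sqrt L)^-1)%:C * pairing (fun j => Ec j t) (fun j => c n j t).
Proof.
rewrite pairingE -cintZ; last by apply: ccontinuousM; exact: ccontinuous_fourier_sum.
by congr cint; apply/funext => x; rewrite fourier_sum_delta0 mulrC.
Qed.

(** Three terms vanish: transport since [kap 0 = 0], the coupling [sqrt ((n - 1) n)] at [n = 1], and
    the field term, which is the integral of [E C_0]. If level 1 is truncated, both sides are
    zero. *)
Lemma dc10E t : 0 <= t -> dc 1 0 t = (dal t / al t)%:C * c 1 0 t.
Proof.
move=> t0; have [NH1|NH1] := leqP NH 1.
  have c0 : c 1 0 = fun=> 0 by apply/funext => s; apply: (@c_zero 1).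
  by rewrite /dc c0 (cdtE t0 (has_cdt_cst 0 t)) mulr0.
have := vlasov_pairing (delta (- 0)) NH1 t0.
rewrite !pairing_delta// !pairing_wavenumber_delta// => ->.
rewrite oppr0 cint_field_delta0 pairing_field_density//.
rewrite !mulr1n subrr !mul0r sqrtr0 rmorph0 wavenumber0 !mul0r oppr0 !mulr0.
by rewrite !addr0 mulr0 !addr0 mul1r.
Qed.

(** For [NH] equal to 1 or 2 the convention sets [c_2] to zero, while terms on the right with [c_0]
    or [c_1] need not vanish. For [NH = 0] all coefficients are zero. *)
Lemma dc20E t : NH <> 1%N -> NH <> 2%N -> 0 <= t ->
  dc 2 0 t = (dal t / al t)%:C * (2 * c 2 0 t + (Num.sqrt 2)%:C * c 0 0 t) +
    (al t * Num.sqrt 2 / Num.sqrt L)%:C *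
      pairing (fun j => Ec j t) (fun j => c 1 j t).
Proof.
move=> NH1 NH2 t0; have [NH0|NH0] := posnP NH.
  have c0 (n j : int) s : c n j s = 0 by apply: (fh_convention sol); rewrite NH0; lia.
  have -> : dc 2 0 t = 0.
    by rewrite /dc (_ : c 2 0 = fun=> 0) ?(cdtE t0 (has_cdt_cst 0 t))//; apply/funext.
  rewrite [X in _ = _ + _ * X]pairing_eq0r; last by move=> j; rewrite c0.
  by rewrite !c0 !(mulr0, addr0).
have NH3 : (2 < NH)%N by lia.
have := vlasov_pairing (delta (- 0)) NH3 t0.
rewrite !pairing_delta// !pairing_wavenumber_delta// => ->.
rewrite oppr0 cint_field_delta0.
have -> : ((2%:R - 1) * 2%:R : R) = 2 by rewrite -[2%:R - 1]/(1 + 1 - 1) addrK mul1r.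
rewrite wavenumber0 !mul0r oppr0 !mulr0 !addr0 mulr0 addr0.
rewrite [(_ / Num.sqrt L)%:C]rmorphM /=.
by rewrite mulrA.
Qed.

Lemma mass_momentum_conserved k t : (k <= 1)%N -> 0 <= t ->
  has_cdt (fun s => c k%:Z 0 s / (al s ^+ k)%:C) t 0.
Proof.
move=> k1 t0; have [->|->] : k = 0%N \/ k = 1%N by lia.
  have := has_cdt_c 0 freq0_bound t0; rewrite dc0E// wavenumber0 mul0r mulr0.
  by apply: has_cdt_congr => // s _; rewrite expr0 divr1.
have h := has_cdtM (has_cdt_c 1 freq0_bound t0)
  (has_cdt_real (has_dtV (lt0r_neq0 (al_gt0 t)) (has_dt_al t0))).
move: h; rewrite dc10E// (_ : _ + _ = 0).
  by apply: has_cdt_congr => // s _; rewrite expr1 fmorphV.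
rewrite -[X in X + _]mulrA [c _ _ _ * _]mulrC mulrA -mulrA [c _ _ _ * _]mulrC mulrA.
rewrite -mulrDl -rmorphM -rmorphD /= (_ : _ + _ = 0) ?rmorph0 ?mul0r//.
by field; rewrite gt_eqF// al_gt0.
Qed.

(* The factor [Ec (- k)] covers [k = 0], where [Ec] vanishes but [c 1] need not. *)
Lemma dE_E k t : `|k| <= Nx%:Z -> 0 <= t ->
  dE k t * Ec (- k) t = - ((al t)^-1)%:C * (c 1 k t * Ec (- k) t).
Proof.
move=> kN t0; have [->|k0] := eqVneq k 0; first by rewrite oppr0 field_coef0// !mulr0.
have kk : kap k != 0 by rewrite wavenumber_eq0.
suff -> : dE k t = - ((al t)^-1)%:C * c 1 k t by rewrite mulrA.
apply: (mulfI kk); rewrite mulrCA -dc0E//.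
have := has_cdtZ (kap k) (has_cdt_E kN t0).
move=> /(has_cdt_congr t0 (g := c 0 k)) h.
have {}h : has_cdt (c 0 k) t (kap k * dE k t).
  by apply: h => s s0; rewrite field_coefE.
by rewrite /dc (cdtE t0 h).
Qed.

(** Reality of the field turns [|E^j|^2] into [E^j E^(-j)], so the energy becomes polynomial in the
    coefficients and [1 / alpha], and the product rules apply. *)
Lemma total_energyE t : 0 <= t ->
  total_energy L alpha0 gamma Nx Ec c t =
  (Num.sqrt L / 2 * (al t)^-1 ^+ 2)%:C * ((Num.sqrt 2)%:C * c 2 0 t + c 0 0 t)
  + 2^-1 * pairing (fun j => Ec j t) (fun j => Ec j t).
Proof.
move=> t0; rewrite /total_energy; congr (_ * _ + _).
  by congr (_%:C); field; rewrite gt_eqF// al_gt0.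
rewrite rmorphM /= fmorphV /= rmorph_nat; congr (_ * _).
rewrite rmorph_sum /=; apply: eq_bigr => i _.
have -> : Ec (- freq i) t = conjc (Ec (freq i) t).
  apply: (real_fourier_sum_coef L_gt0 (a := fun j => Ec j t));
    last exact: frequency_bound.
  exact: (fh_field_real sol).
case: (Ec _ t) => p q /=; rewrite sqr_sqrtr ?addr_ge0 ?sqr_ge0//.
by apply/eqP; rewrite eq_complex /=; apply/andP; split; apply/eqP; ring.
Qed.

Lemma energy_conserved t : NH <> 1%N -> NH <> 2%N -> 0 <= t ->
  total_energy L alpha0 gamma Nx Ec c t = total_energy L alpha0 gamma Nx Ec c 0.
Proof.
move=> NH1 NH2; apply: has_cdt0_cst => {}t t0.
apply: (has_cdt_congr t0 (fun s s0 => esym (total_energyE s0))).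
have dV := has_dtV (lt0r_neq0 (al_gt0 t)) (has_dt_al t0).
have dA := has_cdt_real (has_dtZ (k := Num.sqrt L / 2) (has_dtM dV dV)).
have dX := has_cdtD (has_cdtZ (Num.sqrt 2)%:C (has_cdt_c 2 freq0_bound t0))
  (has_cdt_c 0 freq0_bound t0).
have dP := has_cdt_pairing (fun j jN => has_cdt_E jN t0) (fun j jN => has_cdt_E jN t0).
have := has_cdtD (has_cdtM dA dX) (has_cdtZ 2^-1 dP).
set l := (X in has_cdt _ _ X); suff -> : l = 0 by [].
rewrite /l dc20E// dc0E// wavenumber0 mul0r mulr0 addr0.
set P := pairing (fun j => Ec j t) (fun j => c 1 j t).
have dEP : pairing (fun j => dE j t) (fun j => Ec j t) = - ((al t)^-1)%:C * P.
  rewrite /P [pairing (fun j => Ec j t) _]pairingC /pairing mulr_sumr.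
  apply: eq_bigr => i _.
  by rewrite dE_E// frequency_bound.
rewrite [pairing (fun j => Ec j t) (fun j => dE j t)]pairingC dEP.
have a0 : al t != 0 by rewrite gt_eqF// al_gt0.
have L0 : (Num.sqrt L)%:C != 0.
  by rewrite eq_complex /= eqxx andbT gt_eqF// sqrtr_gt0.
have s2 : (Num.sqrt 2)%:C * (Num.sqrt 2)%:C = 2 :> R[i].
  by rewrite -rmorphM /= -expr2 sqr_sqrtr// rmorph_nat.
move: (al t) (dal t) a0 => ra rd a0.
rewrite !(rmorphM, fmorphV, rmorphN, rmorphD, rmorphXn, rmorph_nat) /=.
have {}a0 : ra%:C != 0 by rewrite eq_complex /= eqxx andbT.
move: ra%:C (Num.sqrt L)%:C (Num.sqrt 2)%:C rd%:C a0 L0 s2 => A S q D a0 L0 s2.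
(* The [c_2] terms cancel outright. The [c_0] terms, due to the scaling, and the terms in [P],
   exchanged between kinetic and field energy, each leave the factor [q^2 - 2], with
   [q = sqrt 2]. *)
transitivity (S * D / (2 * A ^+ 3) * (q * q - 2) * c 0 0 t + (q * q - 2) / (2 * A) * P).
  by field; rewrite a0 L0.
by rewrite s2 subrr mulr0 !mul0r addr0.
Qed.

(** * Growth of the weighted norm *)

Local Notation u n t x := (complex.Re (C n t x)).
Local Notation eps t x := (complex.Re (E t x)).

Lemma coef_realE (n : int) t x : 0 <= t -> C n t x = (u n t x)%:C.
Proof. by move=> t0; case: (C n t x) (fh_coef_real sol n t0 x) => p q /= ->. Qed.

Lemma field_realE t x : 0 <= t -> E t x = (eps t x)%:C.
Proof. by move=> t0; case: (E t x) (fh_field_real sol t0 x) => p q /= ->. Qed.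

Lemma continuous_u (n : int) t : continuous (fun x => u n t x).
Proof. by case: (ccontinuous_fourier_sum L Nx (fun j => c n j t)). Qed.

Lemma continuous_eps t : continuous (fun x => eps t x).
Proof. by case: (ccontinuous_fourier_sum L Nx (fun j => Ec j t)). Qed.

Lemma cint_ReE (f : R -> R[i]) (g : R -> R) : (forall x, f x = (g x)%:C) ->
  cint L f = (\int[mu]_(x in `]0, L[) g x)%:C.
Proof.
move=> fg; rewrite cint_real; last by move=> x; rewrite fg.
by congr (_%:C); apply: eq_Rintegral => x _; rewrite fg.
Qed.

Lemma pairing_coef_real (n m : int) t : 0 <= t ->
  pairing (fun j => c n j t) (fun j => c m j t) =
  (\int[mu]_(x in `]0, L[) (u n t x * u m t x))%:C.
Proof.
move=> t0; rewrite pairingE; apply: cint_ReE => x.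
by rewrite rmorphM; congr (_ * _); exact: coef_realE.
Qed.

Lemma cint_field_coef_real (n m : int) t : 0 <= t ->
  cint L (fun x => E t x * C n t x * FS (fun j => c m j t) x) =
  (\int[mu]_(x in `]0, L[) (eps t x * u n t x * u m t x))%:C.
Proof.
move=> t0; apply: cint_ReE => x.
rewrite !rmorphM; congr (_ * _ * _); [exact: field_realE|exact: coef_realE|].
exact: coef_realE.
Qed.

Lemma sum_pairing_dc t : 0 <= t ->
  \sum_(n < NH) pairing (fun j => dc n%:Z j t) (fun j => c n%:Z j t) =
  (\sum_(n < NH)
    (dal t / al t * (n%:R * \int[mu]_(x in `]0, L[) (u n%:Z t x * u n%:Z t x)
      + Num.sqrt ((n%:R - 1) * n%:R) *
        \int[mu]_(x in `]0, L[) (u (n%:Z - 2) t x * u n%:Z t x))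
     + al t * Num.sqrt n%:R *
       \int[mu]_(x in `]0, L[) (eps t x * u (n%:Z - 1) t x * u n%:Z t x)))%:C.
Proof.
(* [Q n] is the transport flux between levels [n - 1] and [n]; by antisymmetry the coupling of level
   [n] to level [n + 1] is [- Q n.+1]. *)
move=> t0; pose Q n := (Num.sqrt n%:R)%:C *
  pairing (fun j => c (n%:Z - 1) j t) (fun j => kap j * c n%:Z j t).
have QE n : (Num.sqrt n.+1%:R)%:C *
    pairing (fun j => c (n%:Z + 1) j t) (fun j => kap j * c n%:Z j t) = - Q n.+1.
  rewrite /Q pairing_wavenumber mulrN.
  have -> : n%:Z + 1 = n.+1%:Z by lia.
  by have -> : n.+1%:Z - 1 = n%:Z by lia.
(* Both end fluxes vanish: [Q 0] through the factor [sqrt 0], [Q NH] through the truncation. *)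
have Qsum : \sum_(n < NH) (Q n - Q n.+1) = 0.
  rewrite -(big_mkord xpredT (fun n => Q n - Q n.+1)) -[LHS]opprK -sumrN.
  under eq_bigr do rewrite opprB.
  rewrite telescope_sumr// /Q sqrtr0 rmorph0 mul0r subr0.
  by rewrite pairing_eq0r ?mulr0 ?oppr0// => j; rewrite c_zero ?mulr0.
rewrite rmorph_sum /=; transitivity (\sum_(n < NH)
    ((dal t / al t * (n%:R * \int[mu]_(x in `]0, L[) (u n%:Z t x * u n%:Z t x)
      + Num.sqrt ((n%:R - 1) * n%:R) *
        \int[mu]_(x in `]0, L[) (u (n%:Z - 2) t x * u n%:Z t x))
     + al t * Num.sqrt n%:R *
       \int[mu]_(x in `]0, L[) (eps t x * u (n%:Z - 1) t x * u n%:Z t x))%:C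
     + ((al t)^-1)%:C * (Q n - Q n.+1))).
  apply: eq_bigr => n _; rewrite vlasov_pairing// QE -/(Q n).
  rewrite !pairing_coef_real// cint_field_coef_real//.
  rewrite [in RHS]rmorphD [in RHS]rmorphM [X in _ = _ * X + _ + _]rmorphD.
  rewrite !(rmorphM _ n%:R) !(rmorphM _ (Num.sqrt ((n%:R - 1) * n%:R))) rmorph_nat.
  by rewrite [X in _ = _ + X + _]rmorphM addrAC.
by rewrite big_split /= -mulr_sumr Qsum mulr0 addr0.
Qed.

(** The squared weighted norm, written with coefficients so that its time derivative is a finite sum
    and no integral has to be differentiated. *)
Definition energy_norm2 t : R :=
  al t * \sum_(n < NH) complex.Re (pairing (fun j => c n%:Z j t) (fun j => c n%:Z j t)).

Definition denergy_norm2 t : R :=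
  dal t * \sum_(n < NH) complex.Re (pairing (fun j => c n%:Z j t) (fun j => c n%:Z j t))
  + al t * (2 * \sum_(n < NH)
      complex.Re (pairing (fun j => dc n%:Z j t) (fun j => c n%:Z j t))).

Lemma has_dt_energy_norm2 t : 0 <= t -> has_dt energy_norm2 t (denergy_norm2 t).
Proof.
move=> t0; apply: has_dtM; first exact: has_dt_al.
rewrite mulr_sumr; apply: has_dt_sum => n _.
have [h _] := has_cdt_pairing (fun j jN => has_cdt_c n%:Z jN t0)
  (fun j jN => has_cdt_c n%:Z jN t0).
by apply: has_dt_eq h => //; rewrite ReD [in X in _ + X]pairingC; ring.
Qed.

Lemma energy_norm2E t : 0 <= t ->
  energy_norm2 t = al t * \sum_(n < NH) \int[mu]_(x in `]0, L[) u n%:Z t x ^+ 2.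
Proof.
move=> t0; congr (_ * _); apply: eq_bigr => n _; by rewrite pairing_coef_real.
Qed.

Lemma denergy_norm2_le t : 0 <= t ->
  denergy_norm2 t <= alpha0 ^+ 2 / (2 * gamma) * energy_norm2 t.
Proof.
move=> t0; pose d := - (dal t / al t); pose K := alpha0 ^+ 2 / (2 * gamma).
have al0 : al t != 0 by rewrite gt_eqF// al_gt0.
have g0 : gamma != 0 by rewrite gt_eqF.
have a00 : alpha0 != 0 by rewrite gt_eqF.
have dE : d = gamma * al t ^+ 2 * sup_norm L (E t) ^+ 2 / (2 * alpha0 ^+ 2).
  by rewrite /d /dalpha; field; rewrite al0 a00.
have d0 : 0 <= d.
  by rewrite dE; apply: divr_ge0; apply: mulr_ge0; rewrite ?sqr_ge0//;
    apply: mulr_ge0; rewrite ?sqr_ge0// ltW.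
have K0 : 0 <= K by rewrite divr_ge0 ?sqr_ge0// mulr_ge0// ltW.
(* The summand [1/2] beside [n] is the derivative of the prefactor [alpha], after [2 * alpha] is
   taken out of the whole expression. *)
pose F (n : nat) x := (- d * (n%:R + 2^-1)) * u n%:Z t x ^+ 2
  + ((- d * Num.sqrt ((n%:R - 1) * n%:R)) * (u (n%:Z - 2) t x * u n%:Z t x)
  + (al t * Num.sqrt n%:R) * (eps t x * u (n%:Z - 1) t x * u n%:Z t x)).
have c2 (n m : int) : continuous (fun x => u n t x * u m t x).
  by move=> x; apply: cvgM; exact: continuous_u.
have c1 (n : int) : continuous (fun x => u n t x ^+ 2) by exact: c2.
have c3 (n m : int) : continuous (fun x => eps t x * u n t x * u m t x).
  move=> x; apply: cvgM; last exact: continuous_u.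
  by apply: cvgM; [exact: continuous_eps|exact: continuous_u].
have cZ (k : R) (h : R -> R) : continuous h -> continuous (fun x => k * h x).
  by move=> ch x; apply: cvgM; [exact: cvg_cst|exact: ch].
have cD (h1 h2 : R -> R) : continuous h1 -> continuous h2 ->
    continuous (fun x => h1 x + h2 x).
  by move=> ch1 ch2 x; apply: cvgD; [exact: ch1|exact: ch2].
have Fc n : continuous (F n).
  by apply: (cD _ _ (cZ _ _ (c1 _)) (cD _ _ (cZ _ _ (c2 _ _)) (cZ _ _ (c3 _ _)))).
have JZ (k : R) (h : R -> R) : continuous h ->
    \int[mu]_(x in `]0, L[) (k * h x) = k * \int[mu]_(x in `]0, L[) h x.
  by move=> ch; rewrite RintegralZl//; exact: continuous_integrable_oo.
have JD (h1 h2 : R -> R) : continuous h1 -> continuous h2 ->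
    \int[mu]_(x in `]0, L[) (h1 x + h2 x) =
    \int[mu]_(x in `]0, L[) h1 x + \int[mu]_(x in `]0, L[) h2 x.
  by move=> ch1 ch2; rewrite RintegralD//; exact: continuous_integrable_oo.
have JF n : \int[mu]_(x in `]0, L[) F n x =
    (- d * (n%:R + 2^-1)) * \int[mu]_(x in `]0, L[) (u n%:Z t x * u n%:Z t x)
  + ((- d * Num.sqrt ((n%:R - 1) * n%:R)) *
      \int[mu]_(x in `]0, L[) (u (n%:Z - 2) t x * u n%:Z t x)
  + (al t * Num.sqrt n%:R) *
      \int[mu]_(x in `]0, L[) (eps t x * u (n%:Z - 1) t x * u n%:Z t x)).
  rewrite /F JD; [|exact: cZ|by apply: cD; exact: cZ].
  by rewrite JD ?JZ//; exact: cZ.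
have dE2 : denergy_norm2 t = 2 * al t * \int[mu]_(x in `]0, L[) \sum_(n < NH) F n x.
  rewrite Rintegral_bigsum// /denergy_norm2.
  have -> : \sum_(n < NH)
        complex.Re (pairing (fun j => dc n%:Z j t) (fun j => c n%:Z j t))
      = complex.Re (\sum_(n < NH) pairing (fun j => dc n%:Z j t) (fun j => c n%:Z j t)).
    by rewrite (big_morph _ ReD (erefl _)).
  rewrite sum_pairing_dc//= !mulr_sumr -big_split /=; apply: eq_bigr => n _.
  rewrite pairing_coef_real//= JF /d; field; exact: al0.
(* The dissipation inequality is used at each [x] separately, with [p = alpha * E(x)]. The constant
   [K] is chosen so that [4 * d * K] is exactly [alpha^2 * |E|_oo^2], which dominates [p^2]. *)
have FleK x : x \in `]0, L[ ->
    \sum_(n < NH) F n x <= K / 2 * \sum_(n < NH) u n%:Z t x ^+ 2.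
  move=> xL; have p2 : (al t * eps t x) ^+ 2 <= 4 * d * K.
    have -> : 4 * d * K = al t ^+ 2 * sup_norm L (E t) ^+ 2.
      by rewrite dE /K; field; rewrite g0 a00.
    rewrite exprMn ler_wpM2l ?sqr_ge0//.
    have := normc_le_sup_norm Nx L_gt0 (fun j => Ec j t) xL.
    rewrite -/(E t x) field_realE// /Normc.normc /= expr0n /= addr0 sqrtr_sqr => h.
    rewrite -(real_normK (num_real (eps t x))); apply: ler_pM => //.
  have Uge j : NH%:Z <= j -> u j t x = 0.
    move=> jN; rewrite /hermite_coef fourier_sum_eq0// => i.
    by apply: (fh_convention sol); right.
  apply: le_trans (hermite_dissipation Uge K0 d0 p2).
  rewrite !mulr_sumr -big_split /= le_eqVlt; apply/orP; left; apply/eqP.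
  by apply: eq_bigr => n _; rewrite /F; ring.
rewrite dE2 energy_norm2E// -/K.
have -> : K * (al t * \sum_(n < NH) \int[mu]_(x in `]0, L[) u n%:Z t x ^+ 2) =
    2 * al t * \int[mu]_(x in `]0, L[) (K / 2 * \sum_(n < NH) u n%:Z t x ^+ 2).
  rewrite JZ ?Rintegral_bigsum//; last first.
    by apply: continuous_bigsum => n; exact: c1.
  by field.
rewrite ler_wpM2l//; first by rewrite mulr_ge0// ltW// al_gt0.
apply: le_Rintegral => //.
- apply: continuous_integrable_oo; exact: continuous_bigsum.
- apply: continuous_integrable_oo; apply: cZ; apply: continuous_bigsum => n; exact: c1.
Qed.

Lemma weighted_norm_le t : 0 <= t ->
  (weighted_norm L alpha0 gamma Nx Ec t (FH_distribution L alpha0 gamma Nx Ec NH c t) <=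
   weighted_norm L alpha0 gamma Nx Ec 0 (FH_distribution L alpha0 gamma Nx Ec NH c 0)
   * (expR (alpha0 ^+ 2 * t / (4 * gamma)))%:E)%E.
Proof.
move=> t0.
have Cr s : 0 <= s -> forall n : int, real_valued (C n s).
  by move=> s0 n; exact: (fh_coef_real sol).
rewrite !weighted_normE//; try by apply: Cr.
rewrite -EFinM lee_fin -!energy_norm2E//.
(* Gronwall's lemma bounds the squared norm, with rate [alpha0^2 / (2 gamma)]; the square root
   halves it. *)
have -> : expR (alpha0 ^+ 2 * t / (4 * gamma)) =
    Num.sqrt (expR (alpha0 ^+ 2 / (2 * gamma) * t)).
  rewrite -[LHS]ger0_norm ?expR_ge0// -sqrtr_sqr -expRM_natl; congr (Num.sqrt (expR _)).
  by field; rewrite gt_eqF.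
rewrite -sqrtrM; last first.
  rewrite energy_norm2E// mulr_ge0 ?(ltW (al_gt0 _))//; apply: sumr_ge0 => n _.
  by apply: Rintegral_ge0 => x _; rewrite sqr_ge0.
rewrite ler_wsqrtr//.
exact: (gronwall has_dt_energy_norm2 denergy_norm2_le).
Qed.

End Solution.

Unset Implicit Arguments.

(* Energy is conserved only if the equation for C_2 is part of the scheme,
   which fails for NH = 1, 2. The definition of alpha yields
   alpha'/alpha = - gamma (alpha/alpha0)^2 |E|^2 / 2, hence the growth rate
   alpha0^2 / (4 gamma), which is 1 / (4 gamma) for alpha0 = 1; the latter
   rate is false for large alpha0. *)
Theorem theorem3p1 (R : realType) (L alpha0 gamma : R)
    (L_gt0 : 0 < L) (alpha0_gt0 : 0 < alpha0) (gamma_gt0 : 0 < gamma)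
    (NH Nx : nat) (c : int -> int -> R -> R[i]) (Ec : int -> R -> R[i])
    (Phi : R -> R -> R[i]) (rho0 : R -> R)
    (sol : FourierHermite_solution L alpha0 gamma Nx Ec NH c Phi rho0) :
  let alpha := alpha L alpha0 gamma Nx Ec in
  let energy := total_energy L alpha0 gamma Nx Ec c in
  let norm := weighted_norm L alpha0 gamma Nx Ec in
  let f := FH_distribution L alpha0 gamma Nx Ec NH c in
  let E := electric_field L Nx Ec in
  [/\ (forall k : nat, (k <= 1)%N -> forall t, 0 <= t ->
         has_cdt (fun s => c k 0 s / (alpha s ^+ k)%:C) t 0),
      (NH <> 1%N -> NH <> 2%N -> forall t, 0 <= t -> energy t = energy 0),
      ((norm 0%R (f 0%R) < +oo)%E -> forall t, 0 <= t ->
         (norm t (f t) <=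
          norm 0%R (f 0%R) * (expR (alpha0 ^+ 2 * t / (4 * gamma)))%:E)%E) &
      (forall T, 0 < T -> exists2 CT : R, 0 < CT &
         forall t, 0 <= t <= T -> sup_norm L (E t) <= CT)].
Proof.
split.
- by move=> k k1 t t0; exact: (mass_momentum_conserved L_gt0 alpha0_gt0 gamma_gt0 sol).
- by move=> NH1 NH2 t t0; exact: (energy_conserved L_gt0 alpha0_gt0 gamma_gt0 sol).
- by move=> _ t t0; exact: (weighted_norm_le L_gt0 alpha0_gt0 gamma_gt0 sol).
- by move=> T T0; exact: (sup_norm_field_bounded L_gt0 (fh_field_derivable sol)).
Qed.
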